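(* Let $\alpha\ge0$, $1\le s\le\infty$, $\mu>1-1/s$, $\mu>0$ (with $1/\infty=0$). For $N\in\mathbb N$ put $$\varepsilon_N(W^\mu_s)=\sup_{f\in L_{2,w},\ \|f\|_{s,\mu}\le1}\|(f-S_Nf)\sqrt w\|_C .$$ Then there are constants $c_1,c_2>0$ depending only on $\alpha,\mu,s$ such that for every integer $N\ge1$, $$c_1N^{-\mu-1/s+1}\le\varepsilon_N(W^\mu_s)\le c_2N^{-\mu-1/s+1}.$$
   Context: Let $w(t)=t^\alpha e^{-t}$ on $(0,\infty)$, and let $L_{2,w}$ be the real Hilbert space of functions square-summable with weight $w$, with $\langle f,g\rangle=\int_0^\infty t^\alpha e^{-t}f(t)g(t)\,dt$. The Laguerre polynomials are $L_k^{(\alpha)}(t)=\sum_{m=0}^k\frac{\Gamma(k+\alpha+1)}{\Gamma(m+\alpha+1)(k-m)!}\frac{(-t)^m}{m!}$, and $\ell_k^{(\alpha)}=\left(\frac{k!}{\Gamma(k+\alpha+1)}\right)^{1/2}L_k^{(\alpha)}$, $k\in\mathbb N_0=\{0,1,2,\dots\}$. $\|g\|_C=\sup_{t>0}|g(t)|\in[0,\infty]$ for real-valued continuous $g$ on $(0,\infty)$. For $\mu>0$ and $\underline k=\max\{1,k\}$: $\|f\|_{s,\mu}^s=\sum_{k=0}^\infty\underline k^{s\mu}|\langle f,\ell_k^{(\alpha)}\rangle|^s$ for $1\le s<\infty$, $\|f\|_{\infty,\mu}=\sup_k\underline k^\mu|\langle f,\ell_k^{(\alpha)}\rangle|$. For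 $\mu>1-1/s$ and $\|f\|_{s,\mu}<\infty$, $f\sqrt w$ is identified with its continuous representative $\sum_k\langle f,\ell_k^{(\alpha)}\rangle\ell_k^{(\alpha)}\sqrt w$ (absolutely and uniformly convergent). The Fourier partial sum is $S_Nf=\sum_{k=0}^N\langle f,\ell_k^{(\alpha)}\rangle\ell_k^{(\alpha)}$. *)

(* Defs.v *)
From HB Require Import structures.
From mathcomp Require Import all_boot all_order all_algebra.
From mathcomp Require Import all_classical all_reals all_analysis.

Set Implicit Arguments.
Unset Strict Implicit.
Unset Printing Implicit Defensive.

Import Order.TTheory GRing.Theory Num.Theory.
Import numFieldNormedType.Exports.

Local Open Scope classical_set_scope.
Local Open Scope ring_scope.

Definition halfline (R : realType) : set R := [set t | 0 < t].
Arguments halfline : clear implicits.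

(* Euler's integral; the integral converges for 0 < x. *)
Definition Gamma (R : realType) (x : R) : R :=
  \int[@lebesgue_measure R]_(t in halfline R) (t `^ (x - 1) * expR (- t)).

Section Laguerre.
Variables (R : realType) (alpha : R).

Definition weight (t : R) : R := t `^ alpha * expR (- t).

Definition laguerre (k : nat) (t : R) : R :=
  \sum_(m < k.+1)
     (Gamma (k%:R + alpha + 1) / (Gamma (m%:R + alpha + 1) * (k - m)`!%:R))
     * ((- t) ^+ m / m`!%:R).

Definition nlaguerre (k : nat) (t : R) : R :=
  Num.sqrt (k`!%:R / Gamma (k%:R + alpha + 1)) * laguerre k t.

(* Functions on the half-line are represented by functions R -> R whose values
   outside ]0, +oo[ are never used. *)
Definition L2w : set (R -> R) :=
  [set f : R -> R | measurable_fun (halfline R) f /\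
     (@lebesgue_measure R).-integrable (halfline R)
       (fun t => (f t ^+ 2 * weight t)%:E)].

Definition inner (f g : R -> R) : R :=
  \int[@lebesgue_measure R]_(t in halfline R) (weight t * f t * g t).

Definition coeff (f : R -> R) (k : nat) : R := inner f (nlaguerre k).

Definition partial_sum (N : nat) (f : R -> R) (t : R) : R :=
  \sum_(k < N.+1) coeff f k * nlaguerre k t.

(* The value at -oo is irrelevant: only 1 <= s is considered. *)
Definition Wnorm (s : \bar R) (mu : R) (f : R -> R) : \bar R :=
  match s with
  | r%:E => ((\sum_(0 <= k <oo)
      ((maxn 1 k)%:R `^ (r * mu) * `|coeff f k| `^ r)%:E) `^ r^-1)%E
  | +oo%E => ereal_sup
      (range (fun k : nat => ((maxn 1 k)%:R `^ mu * `|coeff f k|)%:E))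
  | -oo%E => 0%E
  end.

(* f * sqrt w is identified with its continuous representative, the sum of its
   Fourier-Laguerre series; that series converges absolutely and uniformly when
   Wnorm s mu f is finite and mu > 1 - 1/s. *)
Definition cont_rep (f : R -> R) (t : R) : R :=
  limn (series (fun k => coeff f k * nlaguerre k t * Num.sqrt (weight t))).

Definition Cnorm (g : R -> R) : \bar R :=
  ereal_sup [set `|g t|%:E | t in halfline R].

Definition remainder (N : nat) (f : R -> R) (t : R) : R :=
  cont_rep f t - partial_sum N f t * Num.sqrt (weight t).

Definition eps (s : \bar R) (mu : R) (N : nat) : \bar R :=
  ereal_sup [set Cnorm (remainder N f) |
    f in [set f : R -> R | L2w f /\ (Wnorm s mu f <= 1)%E]].

End Laguerre.

(* Main.v *)
(* Everything rests on the uniform bound |l_k(t) sqrt(w(t))| <= M (k in N, t > 0).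
   Write W = w L_k^2, h_k = ||L_k||^2 and K = k + (alpha + 1)/2.
   - For t <= c/K, with c depending only on alpha, it suffices that the m-th
     coefficient of L_k is at most h_k / Gamma(alpha + 1) * k^m / m! in absolute
     value.
   - On [c/K, 2K], Sonin's function w (L_k^2 + A^2/q) is nonincreasing, where
     A = (alpha - t)/2 L_k + t L_k' and q = K t - t^2/4 - alpha^2/4.
   - For t >= 2K, t W(t) is the integral of -(t W)' over ]t, +oo[, which is
     O(K h_k) because A is a combination of L_(k-1), L_k and L_(k+1).
   The upper estimate follows from Hoelder's inequality for the tail of the
   Fourier series. For the lower one take f = lam * (l_(N+1) + ... + l_(2N)) at
   t = 1/(8N), where all these l_k sqrt(w) are bounded below. *)
Require Import Defs.
From HB Require Import structures.
From mathcomp Require Import all_boot all_order all_algebra.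
From mathcomp Require Import all_classical all_reals all_analysis measurable_realfun.
From mathcomp Require Import zify ring lra.
Import Order.TTheory GRing.Theory Num.Theory.
Import numFieldNormedType.Exports.
Local Open Scope classical_set_scope.
Local Open Scope ring_scope.

Set Implicit Arguments.
Unset Strict Implicit.
Unset Printing Implicit Defensive.

(** * Integrals of functions with exponential decay *)

Lemma expR_sum_le (R : realType) (y : R) (n : nat) : 0 <= y ->
  \sum_(m < n) y ^+ m / m`!%:R <= expR y.
Proof.
move=> y0; rewrite (_ : \sum_(m < n) _ = series (exp_coeff y) n); last first.
  by rewrite /series /= big_mkord.
apply: nondecreasing_cvgn_le; last exact: is_cvg_series_exp_coeff.
apply/nondecreasing_seqP => k; rewrite /series/= big_nat_recr//= lerDl.
exact: exp_coeff_ge0.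
Qed.

Lemma exprn_le_expR (R : realType) (y : R) (n : nat) : 0 <= y ->
  y ^+ n <= n`!%:R * expR y.
Proof.
move=> y0; rewrite mulrC -ler_pdivrMr ?ltr0n ?fact_gt0//.
apply: (le_trans _ (expR_sum_le n.+1 y0)).
by rewrite big_ord_recr/= lerDr sumr_ge0// => i _; rewrite divr_ge0 ?exprn_ge0.
Qed.

Lemma weight_ge0 (R : realType) (a t : R) : 0 <= weight a t.
Proof. by rewrite mulr_ge0 ?powR_ge0 ?expR_ge0. Qed.

Lemma powR_le_1Dxn (R : realType) (a t : R) : 0 <= a -> 0 <= t ->
  t `^ a <= 1 + t ^+ (Num.truncn a).+1.
Proof.
move=> a0 t0; have [t1|/ltW t1] := leP 1 t.
  rewrite (@le_trans _ _ (t ^+ (Num.truncn a).+1)) ?lerDr//.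
  by rewrite -powR_mulrn// ler_powR// ltW// truncnS_gt.
rewrite (@le_trans _ _ 1) ?lerDl ?exprn_ge0//.
have e1 : (1:R) `^ a = 1 by rewrite powR1.
by rewrite -[leRHS]e1 ge0_ler_powR// nnegrE.
Qed.

(** Since t^a <= 1 + t^n with n > a, the product is at most e^(-t) q(t) for a polynomial [q] with
    nonnegative coefficients. Half of the exponential absorbs each monomial, by y^i <= i! e^y at y =
    t/2. *)
Lemma weight_poly_bound (R : realType) (a : R) (p : {poly R}) : 0 <= a ->
  exists M : R, forall t, 0 <= t ->
    `|weight a t * p.[t]| <= M * expR (- (t / 2)).
Proof.
move=> a0; set n := (Num.truncn a).+1.
pose q : {poly R} := (1 + 'X^n) * \poly_(i < size p) `|p`_i|.
have qb : exists M : R, forall t, 0 <= t -> q.[t] <= M * expR (t / 2).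
  exists (\sum_(i < size q) `|q`_i| * (2 ^+ i * i`!%:R)) => t t0.
  rewrite horner_coef mulr_suml ler_sum// => i _.
  rewrite (le_trans (ler_norm _))// normrM -!mulrA ler_wpM2l//.
  have t20 : 0 <= t / 2 by lra.
  rewrite normrX (ger0_norm t0) -[X in X ^+ _](divfK (_ : 2 != 0))//.
  by rewrite exprMn mulrC ler_wpM2l// ?exprn_ge0// exprn_le_expR.
have {qb} [M qM] := qb; exists M => t t0.
rewrite /weight normrM ger0_norm ?weight_ge0//.
have -> : - t = - (t / 2) - t / 2 by lra.
rewrite expRD mulrAC [leLHS]mulrA -mulrA [X in _ * X]mulrC mulrA.
rewrite ler_wpM2r ?expR_ge0// expRN ler_pdivrMr ?expR_gt0//.
apply: le_trans (qM t t0); rewrite /q hornerM ler_pM ?powR_ge0//.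
  by rewrite hornerD hornerXn hornerC powR_le_1Dxn.
rewrite horner_coef horner_poly (le_trans (ler_norm_sum _ _ _))// ler_sum// => i _.
by rewrite normrM normrX (ger0_norm t0).
Qed.

Lemma cvgr_expR_half (R : realType) : expR (- (x / 2)) @[x --> +oo] --> (0 : R).
Proof.
apply: (@cvg_comp _ _ _ (fun x : R => x / 2) (fun y => expR (- y)) _ (pinfty_nbhs R));
  last exact: cvgr_expR.
by apply: gt0_cvgMly => //; rewrite invr_gt0.
Qed.

Lemma is_derive_expRN_half (R : realType) (c x : R) :
  is_derive x 1 (fun x => c * expR (- (x / 2))) (- (c / 2) * expR (- (x / 2))).
Proof.
have H : is_derive x 1 (fun x : R => - (x / 2)) (- 2^-1).
  rewrite (_ : (fun _ => _) = (fun x : R => (- 2^-1) *: x)); last first.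
    by apply/funext => y; rewrite /GRing.scale/=; lra.
  by apply: is_derive_eq; rewrite /GRing.scale/= mulr1.
apply: is_derive_eq.
rewrite /GRing.scale/=. lra.
Qed.

Lemma continuous_expRN_half (R : realType) (c : R) :
  continuous (fun x : R => c * expR (- (x / 2))).
Proof.
move=> x; apply: differentiable_continuous; apply/derivable1_diffP.
by have [] := is_derive_expRN_half c x.
Qed.

(** Improper fundamental theorem for integrands of either sign, behind every integration by parts
    against the weight. Only right continuity of [F] at [a] is assumed, so that powers of t can be
    treated from 0 on. *)
Lemma FTC2y_expR_decay (R : realType) (f F : R -> R) (a M : R) :
  0 <= a ->
  {within `[a, +oo[, continuous f} ->
  (forall x, a < x -> is_derive x 1 F (f x)) ->
  F x @[x --> a^'+] --> F a -> F x @[x --> +oo] --> (0 : R) ->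
  (forall x, a <= x -> `|f x| <= M * expR (- (x / 2))) ->
  (@lebesgue_measure R).-integrable `]a, +oo[ (EFin \o f) /\
  \int[@lebesgue_measure R]_(x in `]a, +oo[) f x = - F a.
Proof.
move=> a0 cf dF Fa Fy fM.
pose mu := @lebesgue_measure R.
pose g (x : R) : R := M * expR (- (x / 2)).
pose G (x : R) : R := - (2 * M) * expR (- (x / 2)).
have M0 : 0 <= M.
  have := le_trans (normr_ge0 _) (fM a (lexx a)).
  by rewrite pmulr_lge0// expR_gt0.
have cg : continuous g by exact: continuous_expRN_half.
have dG (x : R) : is_derive x 1 G (g x).
  rewrite (_ : g x = - (- (2 * M) / 2) * expR (- (x / 2))).
    exact: is_derive_expRN_half.
  by rewrite /g; congr (_ * _); field.
have cG : continuous G by exact: continuous_expRN_half.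
have Gy : G x @[x --> +oo] --> (0 : R).
  by rewrite -(mulr0 (- (2 * M))); apply: cvgMr; exact: cvgr_expR_half.
have g0 x : 0 <= g x by rewrite mulr_ge0// expR_ge0.
have mf : measurable_fun `[a, +oo[ f by exact: subspace_continuous_measurable_fun.
have mg : measurable_fun `[a, +oo[ g.
  by apply: measurable_funTS; exact: continuous_measurable_fun.
have Ig : (\int[mu]_(x in `[a, +oo[) (g x)%:E = (- G a)%:E)%E.
  rewrite (@ge0_continuous_FTC2y _ g G a 0)//.
  - by rewrite sub0e EFinN.
  - exact: continuous_subspaceT.
  - exact/cvg_at_right_filter/cG.
  - by move=> x _; rewrite derive1E; have [_ ->] := dG x.
have ig : mu.-integrable `[a, +oo[ (EFin \o g).
  apply/integrableP; split; first exact/measurable_EFinP.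
  under eq_integral do rewrite /= ger0_norm//.
  by rewrite Ig ltry.
have if_ : mu.-integrable `[a, +oo[ (EFin \o f).
  apply: le_integrable ig => //; first exact/measurable_EFinP.
  move=> x /=; rewrite in_itv/= andbT => ax.
  by rewrite lee_fin (ger0_norm (g0 x)) fM.
(* f + g >= 0, so that the fundamental theorem for nonnegative integrands
   applies to it. *)
have Ifg : (\int[mu]_(x in `[a, +oo[) (f x + g x)%:E = (- (F a + G a))%:E)%E.
  rewrite (@ge0_continuous_FTC2y _ (f \+ g) (F \+ G) a 0)//.
  - by rewrite sub0e EFinN.
  - by move=> x ax; have := fM x ax; rewrite ler_norml /= -/(g x); lra.
  - by move=> x; apply: continuousD; [exact: cf|exact: continuous_subspaceT].
  - by rewrite -(addr0 0); exact: cvgD.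
  - by move=> x ax; apply: derivableD; [have [] := dF x ax|have [] := dG x].
  - by apply: cvgD => //; exact/cvg_at_right_filter/cG.
  - move=> x; rewrite in_itv/= andbT => ax.
    have dFx := dF x ax; have dGx := dG x.
    by rewrite derive1E derive_val.
have io : mu.-integrable `]a, +oo[ (EFin \o f).
  by apply: integrableS if_ => //; apply: subset_itvr; rewrite bnd_simp.
split => //; rewrite Rintegral_itv_obnd_cbnd// /Rintegral.
have : (\int[mu]_(x in `[a, +oo[) (f x)%:E = (- F a)%:E)%E.
  rewrite (_ : (- F a)%:E = (- (F a + G a))%:E - (- G a)%:E)%E; last first.
    by rewrite -EFinB; congr EFin; lra.
  rewrite -Ifg -Ig -integralB//; last first.
    rewrite (_ : (fun _ => _) = (EFin \o f) \+ (EFin \o g))%E//.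
    exact: integrableD.
  by apply: eq_integral => x _; rewrite -EFinB; congr EFin; lra.
by move=> ->.
Qed.

Lemma within_continuous_powR (R : realType) (a : R) : 0 <= a ->
  {within `[0, +oo[, continuous (fun t : R => t `^ a)}.
Proof.
rewrite le_eqVlt => /predU1P[<-|a0].
  rewrite (_ : (fun _ => _) = cst 1); last by apply/funext => x; rewrite powRr0.
  by apply: continuous_subspaceT => x; exact: cvg_cst.
apply/continuous_within_itvcyP; split.
  move=> x; rewrite in_itv/= andbT => x0.
  apply: differentiable_continuous; apply/derivable1_diffP.
  by have [] := is_derive1_powR a x0.
by rewrite powR0 ?gt_eqF//; exact: powR_cvg0.
Qed.

Lemma within_continuous_weight_poly (R : realType) (a b : R) (p : {poly R}) :
  0 <= a -> 0 <= b ->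
  {within `[b, +oo[, continuous (fun t => weight a t * p.[t])}.
Proof.
move=> a0 b0.
have sub : `[b, +oo[ `<=` `[0 : R, +oo[ by apply: subset_itvr; rewrite bnd_simp.
apply: (continuous_subspaceW sub).
move=> x; apply: continuousM; last first.
  by apply: continuous_subspaceT => y; exact: continuous_horner.
apply: continuousM; first exact: within_continuous_powR.
apply: continuous_subspaceT => y.
apply: (continuous_comp (f := fun t : R => - t)); last exact: continuous_expR.
exact: continuousN.
Qed.

(** The extra factor t in the weight keeps the derivative a polynomial multiple of [weight a], and
    makes the boundary term at 0 vanish. *)
Lemma is_derive_weight_poly (R : realType) (a x : R) (p : {poly R}) : 0 < x ->
  is_derive x 1 (fun t => weight (a + 1) t * p.[t])
    (weight a x * ((a + 1)%:P * p - 'X * p + 'X * p^`()).[x]).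
Proof.
move=> x0.
have xa1 : x `^ (a + 1) = x `^ a * x.
  by rewrite powRD ?powRr1 ?(ltW x0)// (gt_eqF x0) implybT.
have H1 := is_derive1_powR (a + 1) x0.
have H2 : is_derive x 1 (fun t : R => expR (- t)) (- expR (- x)).
  by apply: is_derive_eq; rewrite /GRing.scale/= mulrN1.
have H3 := is_derive_poly p x.
apply: is_derive_eq.
rewrite /GRing.scale/= !hornerE /weight addrK xa1 /=.
ring.
Qed.

Lemma integrable_expR_decay (R : realType) (f : R -> R) (a M : R) : 0 <= a ->
  {within `[a, +oo[, continuous f} ->
  (forall x, a <= x -> `|f x| <= M * expR (- (x / 2))) ->
  (@lebesgue_measure R).-integrable `]a, +oo[ (EFin \o f).
Proof.
move=> a0 cf fM; pose g (x : R) : R := M * expR (- (x / 2)).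
have M0 : 0 <= M.
  have := le_trans (normr_ge0 _) (fM a (lexx a)).
  by rewrite pmulr_lge0// expR_gt0.
have g0 x : 0 <= g x by rewrite mulr_ge0// expR_ge0.
have [ig _] : (@lebesgue_measure R).-integrable `]a, +oo[ (EFin \o g) /\
    \int[@lebesgue_measure R]_(x in `]a, +oo[) g x
      = - (- (2 * M) * expR (- (a / 2))).
  apply: (FTC2y_expR_decay (F := fun x => - (2 * M) * expR (- (x / 2))) (M := M) a0).
  - by apply: continuous_subspaceT; exact: continuous_expRN_half.
  - move=> x _; rewrite (_ : g x = - (- (2 * M) / 2) * expR (- (x / 2))).
      exact: is_derive_expRN_half.
    by rewrite /g; congr (_ * _); field.
  - by apply/cvg_at_right_filter; exact: continuous_expRN_half.
  - by rewrite -(mulr0 (- (2 * M))); apply: cvgMr; exact: cvgr_expR_half.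
  - by move=> x _; rewrite ger0_norm.
apply: le_integrable ig => //.
  apply/measurable_EFinP; apply: (measurable_funS (E := `[a, +oo[)) => //.
    by apply: subset_itvr; rewrite bnd_simp.
  exact: subspace_continuous_measurable_fun.
move=> x /=; rewrite in_itv/= andbT => ax.
by rewrite lee_fin (ger0_norm (g0 x)) fM ?ltW.
Qed.

(** Two uses of 1 + u <= e^u: u = -1/(y+1) gives (y+1)/y >= e^(1/(y+1)), and u = a/(y+1) bounds the
    [a]-th power of this exponential from below. *)
Lemma succ_ratio_powR_ge (R : realType) (a y : R) : 0 <= a -> 0 < y ->
  1 + a / (y + 1) <= ((y + 1) / y) `^ a.
Proof.
move=> a0 y0; have y1 : 0 < y + 1 by lra.
apply: (@le_trans _ _ (expR ((y + 1)^-1) `^ a)).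
  by rewrite -expRM mulrC expR_ge1Dx.
apply: ge0_ler_powR; rewrite ?nnegrE ?expR_ge0 ?divr_ge0 ?(ltW y0) ?(ltW y1)//.
rewrite -[leRHS]invf_div -[expR _]invrK -expRN lef_pV2 ?posrE ?expR_gt0
  ?divr_gt0//.
apply: le_trans (expR_ge1Dx _); rewrite le_eqVlt; apply/orP; left; apply/eqP.
by field; rewrite gt_eqF.
Qed.

(** Here (y+a+1)/(y+a) <= e^(1/(y+a)), and e^(-a/(y+a)) >= 1 - a/(y+a) = y/(y+a). *)
Lemma succ_ratio_powR_le (R : realType) (a y : R) : 0 <= a -> 0 < y ->
  ((y + a + 1) / (y + a)) `^ a <= (y + a) / y.
Proof.
move=> a0 y0; have ya : 0 < y + a by lra.
apply: (@le_trans _ _ (expR ((y + a)^-1) `^ a)).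
  apply: ge0_ler_powR; rewrite ?nnegrE ?expR_ge0 ?divr_ge0 ?(ltW ya)//; first lra.
  apply: le_trans (expR_ge1Dx _); rewrite le_eqVlt; apply/orP; left; apply/eqP.
  by field; rewrite gt_eqF.
rewrite -expRM -[leRHS]invf_div -[expR _]invrK -expRN lef_pV2 ?posrE ?expR_gt0
  ?divr_gt0//.
apply: le_trans (expR_ge1Dx _); rewrite le_eqVlt; apply/orP; left; apply/eqP.
by field; rewrite gt_eqF.
Qed.

(** * Integration of polynomials against the weight *)

(** A linear functional on [{poly R}]: orthogonality, norms and recurrences reduce to identities
    between polynomials. *)
Definition wint (R : realType) (a : R) (p : {poly R}) : R :=
  \int[@lebesgue_measure R]_(t in halfline R) (weight a t * p.[t]).

Lemma halflineE (R : realType) : halfline R = `]0, +oo[%classic.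
Proof. by rewrite set_itvoy. Qed.

Section weighted_integral.
Variables (R : realType) (a : R).
Hypothesis a0 : 0 <= a.
Local Notation mu := (@lebesgue_measure R).
Implicit Types p q : {poly R}.

Lemma measurable_halfline : measurable (halfline R).
Proof. by rewrite halflineE. Qed.

Lemma integrable_wpoly p :
  mu.-integrable (halfline R) (EFin \o (fun t => weight a t * p.[t])).
Proof.
have [M pM] := weight_poly_bound p a0.
rewrite halflineE; apply: (integrable_expR_decay (M := M)) => //.
exact: within_continuous_weight_poly.
Qed.

Lemma wintD p q : wint a (p + q) = wint a p + wint a q.
Proof.
rewrite /wint -RintegralD//; [|exact: measurable_halfline|exact: integrable_wpoly..].
by apply: eq_Rintegral => t _; rewrite hornerD mulrDr.
Qed.

Lemma wintZ c p : wint a (c *: p) = c * wint a p.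
Proof.
rewrite /wint -RintegralZl//; [|exact: measurable_halfline|exact: integrable_wpoly].
by apply: eq_Rintegral => t _; rewrite hornerZ mulrCA.
Qed.

Lemma wintB p q : wint a (p - q) = wint a p - wint a q.
Proof. by rewrite -scaleN1r wintD wintZ mulN1r. Qed.

Lemma le_wint p q : (forall t, 0 < t -> p.[t] <= q.[t]) -> wint a p <= wint a q.
Proof.
move=> pq; apply: le_Rintegral; [exact: measurable_halfline|exact: integrable_wpoly..|].
by move=> t /pq ptqt; rewrite ler_wpM2l ?weight_ge0.
Qed.

(** The integrand is the derivative of [weight (a + 1)] times [p], which vanishes at infinity. The
    lower end stays arbitrary because the bound for large arguments integrates from a positive
    point. *)
Lemma wint_deriv p (x : R) : 0 <= x ->
  \int[mu]_(t in `]x, +oo[)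
    (weight a t * ((a + 1)%:P * p - 'X * p + 'X * p^`()).[t])
  = - (weight (a + 1) x * p.[x]).
Proof.
move=> x0.
set q := (_ + _ : {poly R}).
have a1 : 0 <= a + 1 by rewrite addr_ge0.
have [M qM] := weight_poly_bound q a0.
have [M' pM] := weight_poly_bound p a1.
have cF := @within_continuous_weight_poly R (a + 1) x p a1 x0.
apply: (proj2 (FTC2y_expR_decay (F := fun t => weight (a + 1) t * p.[t])
  (M := M) x0 _ _ _ _ _)).
- exact: within_continuous_weight_poly.
- by move=> y xy; exact: is_derive_weight_poly (le_lt_trans x0 xy).
- by have /continuous_within_itvcyP[] := cF.
- apply: norm_cvg0.
  apply: (@squeeze_cvgr _ _ _ _ (cst 0) (fun t => M' * expR (- (t / 2)))).
  + near=> t; rewrite normr_ge0/=; apply: pM.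
    by near: t; apply: nbhs_pinfty_ge; rewrite num_real.
  + exact: cvg_cst.
  + by rewrite -(mulr0 M'); apply: cvgMr; exact: cvgr_expR_half.
- by move=> y xy; apply: qM; exact: le_trans xy.
Unshelve. all: by end_near. Qed.

(** With suitable [p] this identity yields the recurrence of Gamma, the orthogonality and the
    recurrence of the norms. *)
Lemma wint_by_parts p : wint a ((a + 1)%:P * p - 'X * p + 'X * p^`()) = 0.
Proof.
rewrite /wint halflineE wint_deriv// /weight powR0 ?mul0r ?oppr0//.
by rewrite gt_eqF// ltr_wpDl.
Qed.

Lemma wintXn m : wint a 'X^m = Gamma (m%:R + a + 1).
Proof.
apply: eq_Rintegral => t; rewrite inE/= => t0.
rewrite hornerXn addrK powRD ?(gt_eqF t0) ?implybT// powR_mulrn ?(ltW t0)//.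
by rewrite /weight mulrC mulrA.
Qed.

Lemma Gamma_rec m :
  Gamma (m.+1%:R + a + 1) = (m%:R + a + 1) * Gamma (m%:R + a + 1).
Proof.
have := wint_by_parts 'X^m.
have -> : 'X * ('X^m)^`() = m%:R *: 'X^m :> {poly R}.
  rewrite derivXn; case: m => [|m]; first by rewrite mulr0n mulr0 scale0r.
  by rewrite /= mulrnAr -exprS scaler_nat.
rewrite -exprS mul_polyC wintD wintB !wintZ !wintXn => /eqP.
by rewrite addrAC subr_eq0 => /eqP <-; ring.
Qed.

Lemma Rintegral_sub_wint p (D : set R) :
  measurable (D : set (measurableTypeR R)) -> D `<=` halfline R ->
  (forall t, 0 < t -> 0 <= p.[t]) ->
  \int[mu]_(t in D) (weight a t * p.[t]) <= wint a p.
Proof.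
move=> mD sub p0; have ip := integrable_wpoly p.
have iD : mu.-integrable D (EFin \o (fun t => weight a t * p.[t])).
  by apply: integrableS ip => //; exact: measurable_halfline.
rewrite /wint -lee_fin /Rintegral !fineK//.
- apply: ge0_subset_integral => //; first exact: measurable_halfline.
    by case/integrableP : ip.
  by move=> t t0; rewrite lee_fin mulr_ge0 ?weight_ge0 ?p0.
- by apply: (integrable_fin_num _ ip); exact: measurable_halfline.
- exact: (integrable_fin_num _ iD).
Qed.

(** By the recurrence only Gamma(a+1) needs an integral, and on [1, 2] its integrand is at least
    e^(-2). *)
Lemma Gamma_gt0 m : 0 < Gamma (m%:R + a + 1).
Proof.
elim: m => [|m IH]; last first.
  by rewrite Gamma_rec mulr_gt0// -addrA ltr_wpDl// ltr_wpDl.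
rewrite -wintXn expr0.
pose c : R := expR (- 2).
have sub : `[1, 2] `<=` halfline R.
  by move=> x /=; rewrite in_itv/= /halfline/=; lra.
have iw := integrable_wpoly 1.
have il : mu.-integrable `[1, 2] (EFin \o (fun t => weight a t * 1.[t])).
  apply: integrableS iw => //; exact: measurable_halfline.
apply: (@lt_le_trans _ _ (\int[mu]_(x in `[1, 2]) c)).
  rewrite Rintegral_cst// /= lebesgue_measure_itv/= lte_fin ltr1n.
  by rewrite -EFinD/= mulr_gt0 ?expR_gt0//; lra.
apply: (@le_trans _ _ (\int[mu]_(x in `[1, 2]) (weight a x * 1.[x]))).
  apply: le_Rintegral => //.
  - apply: continuous_compact_integrable; first exact: segment_compact.
    by apply: continuous_subspaceT => x; exact: cvg_cst.
  - move=> x /=; rewrite in_itv/= => /andP[x1 x2].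
    rewrite hornerC mulr1 /weight -[leLHS]mul1r ler_pM ?expR_ge0//.
      by rewrite -[leLHS](powRr0 x) ler_powR.
    by rewrite ler_expR lerN2.
by apply: Rintegral_sub_wint => // t _; rewrite hornerC.
Qed.

End weighted_integral.

(** * Laguerre polynomials *)

Section laguerre_polynomials.
Variables (R : realType) (a : R).
Hypothesis a0 : 0 <= a.
Local Notation g m := (Gamma (m%:R + a + 1)).

Definition lagp (k : nat) : {poly R} :=
  \poly_(m < k.+1) (g k / (g m * (k - m)`!%:R) * ((-1) ^+ m / m`!%:R)).

Lemma laguerre_horner k t : laguerre a k t = (lagp k).[t].
Proof.
rewrite horner_poly; apply: eq_bigr => m _.
by rewrite (exprNn t); ring.
Qed.

Let gS m : g m.+1 = (m.+1%:R + a) * g m.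
Proof. by rewrite Gamma_rec// -natr1; congr (_ * _); ring. Qed.

Let g_neq0 m : g m != 0.
Proof. by rewrite gt_eqF// Gamma_gt0. Qed.

Let Sa_neq0 m : m.+1%:R + a != 0.
Proof. by rewrite gt_eqF// ltr_wpDr. Qed.

(** * Recurrences and the differential equation *)

Lemma coef_lagp_gt k m : (k < m)%N -> (lagp k)`_m = 0.
Proof. by move=> km; rewrite nth_default// (leq_trans (size_poly _ _)). Qed.

(** Ratio of consecutive coefficients, cleared of denominators: it then holds for every [m], both
    sides being 0 for m >= k. It is the differential equation read coefficientwise. *)
Lemma coef_lagp_succ k m : m.+1%:R * (m.+1%:R + a) * (lagp k)`_m.+1 =
  (m%:R - k%:R) * (lagp k)`_m.
Proof.
rewrite !coef_poly !ltnS; case: (ltngtP m k) => [mk|mk|->]; last 2 first.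
- by rewrite !mulr0.
- by rewrite mulr0 subrr mul0r.
have -> : (k - m = (k - m.+1).+1)%N by rewrite -subSn.
have -> : m%:R - k%:R = - (k - m.+1).+1%:R :> R.
  by rewrite -subSn// natrB 1?ltnW//; ring.
rewrite gS !factS !natrM exprS.
have fn n : (n`!%:R : R) != 0 by rewrite pnatr_eq0 -lt0n fact_gt0.
have Sn n : (n.+1%:R : R) != 0 by rewrite pnatr_eq0.
by field; rewrite !nat1r !g_neq0 !fn !Sn Sa_neq0.
Qed.

Lemma coef_lagpS k m : (k.+1%:R - m%:R) * (lagp k.+1)`_m =
  (k.+1%:R + a) * (lagp k)`_m.
Proof.
rewrite !coef_poly !ltnS; case: (ltngtP m k.+1) => [|mk|->]; last 2 first.
- by rewrite leqNgt (ltn_trans _ mk)// !mulr0.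
- by rewrite ltnn subrr mul0r mulr0.
rewrite ltnS => mk; rewrite mk -natrB ?leqW// subSn//.
rewrite gS !factS !natrM.
have fn n : (n`!%:R : R) != 0 by rewrite pnatr_eq0 -lt0n fact_gt0.
have Sn n : (n.+1%:R : R) != 0 by rewrite pnatr_eq0.
by field; rewrite ?nat1r !g_neq0 !fn !Sn.
Qed.

Lemma lagp_ode k : 'X * (lagp k)^`()^`() + ((a + 1)%:P - 'X) * (lagp k)^`()
  = - (k%:R *: lagp k).
Proof.
apply/polyP => i; rewrite coefD mulrBl coefB coefCM !coefXM coefN coefZ !coef_deriv.
have H := coef_lagp_succ k i.
case: i H => [|i] /= H.
  transitivity (1 * (1 + a) * (lagp k)`_1); first by ring.
  by rewrite H; ring.
transitivity (i.+2%:R * (i.+2%:R + a) * (lagp k)`_i.+2 - i.+1%:R * (lagp k)`_i.+1).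
  by rewrite -[i.+2%:R]natr1 -[i.+1%:R]natr1; ring.
by rewrite H; ring.
Qed.

Lemma lagp_derivX k : 'X * (lagp k.+1)^`() =
  k.+1%:R *: lagp k.+1 - (k.+1%:R + a) *: lagp k.
Proof.
apply/polyP => i; rewrite coefB !coefZ -coef_lagpS coefXM coef_deriv.
by case: i => [|i] /=; [|rewrite -mulr_natl]; ring.
Qed.

(** The relation L_k = L_k' - L_(k+1)' multiplied by X, the form in which it combines with
    [lagp_derivX]. *)
Lemma lagp_mulX k : 'X * lagp k = 'X * (lagp k)^`() - 'X * (lagp k.+1)^`().
Proof.
apply/polyP => i; rewrite coefB !coefXM !coef_deriv.
case: i => [|i] /=; first by rewrite subr0.
have H1 := coef_lagp_succ k i; have := coef_lagpS k i.+1.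
have [ik|ki|->] := ltngtP i k.
- move=> H2; have ki : (k%:R - i%:R : R) != 0 by rewrite subr_eq0 gt_eqF// ltr_nat.
  apply: (mulfI ki).
  have -> : (k%:R - i%:R) * (lagp k)`_i = - (i.+1%:R * (i.+1%:R + a) * (lagp k)`_i.+1).
    by rewrite H1; ring.
  transitivity (i.+1%:R * ((k%:R - i%:R) * (lagp k)`_i.+1 -
    (k.+1%:R - i.+1%:R) * (lagp k.+1)`_i.+1)); last by rewrite -!natr1; ring.
  by rewrite H2 -!natr1; ring.
- by rewrite !coef_lagp_gt ?mul0rn ?subrr// ltnS ltnW.
(* The factor k - i used for i < k vanishes here, so the leading coefficients are compared
   directly. *)
- move=> _; rewrite !coef_poly !ltnS !leqnn ltnn !subnn fact0 mul0rn sub0r.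
  rewrite factS natrM exprS.
  have fn n : (n`!%:R : R) != 0 by rewrite pnatr_eq0 -lt0n fact_gt0.
  have Sn n : (n.+1%:R : R) != 0 by rewrite pnatr_eq0.
  by field; rewrite ?nat1r !g_neq0 !fn !Sn.
Qed.

(** * Orthogonality and norms *)

Lemma wint_lagp_orth j k : j != k -> wint a (lagp j * lagp k) = 0.
Proof.
move=> jk; set P := lagp j; set Q := lagp k.
(* For the Wronskian P'Q - PQ' the differential equation turns the integrand into (k - j) P Q. *)
have := wint_by_parts a0 (P^`() * Q - P * Q^`()).
rewrite (_ : _ + _ = (k%:R - j%:R) *: (P * Q)); last first.
  have <- : - (j%:R *: P) * Q + P * (k%:R *: Q) = (k%:R - j%:R) *: (P * Q).
    by rewrite scalerBl mulNr -scalerAl -scalerAr addrC.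
  rewrite -lagp_ode -[k%:R *: Q]opprK -lagp_ode -/P -/Q derivB !derivM.
  ring.
rewrite wintZ// => /eqP; rewrite mulf_eq0 subr_eq0 eqr_nat eq_sym.
by rewrite (negbTE jk) => /eqP.
Qed.

Definition lagnorm2 k : R := wint a (lagp k ^+ 2).
Local Notation h := lagnorm2.

(** Integration by parts applied to L_k L_(k+1): the derivative relations turn the integrand into
    (k+1) L_(k+1)^2 - (k+1+a) L_k^2 plus multiples of L_k L_(k+1), which integrate to 0. *)
Lemma lagnorm2S k : k.+1%:R * h k.+1 = (k.+1%:R + a) * h k.
Proof.
have orth : wint a (lagp k * lagp k.+1) = 0 by rewrite wint_lagp_orth// ltn_eqF.
have := wint_by_parts a0 (lagp k * lagp k.+1).
rewrite (_ : _ + _ = (a + 1) *: (lagp k * lagp k.+1)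
   + ('X * (lagp k.+1)^`() * lagp k + 'X * (lagp k.+1)^`() * lagp k.+1)); last first.
  rewrite -mul_polyC (mulrA 'X) lagp_mulX derivM; ring.
rewrite lagp_derivX wintD// wintZ// orth mulr0 add0r.
rewrite [X in wint a X](_ : _ = k.+1%:R *: (lagp k.+1 ^+ 2)
   - (k.+1%:R + a) *: lagp k ^+ 2 -
   a *: (lagp k * lagp k.+1)).
  by rewrite !wintB// !wintZ// orth mulr0 subr0 => /eqP; rewrite subr_eq0 => /eqP.
rewrite -!mul_polyC polyCD; ring.
Qed.

Lemma lagp0 : lagp 0 = 1.
Proof.
rewrite /lagp poly_def big_ord1 expr0 subnn fact0 mulr1 divff// mul1r divr1.
by rewrite expr0 scale1r.
Qed.

Lemma lagnorm2E k : h k = g k / k`!%:R.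
Proof.
elim: k => [|k IH].
  by rewrite /h lagp0 expr1n fact0 divr1 -(wintXn a) expr0.
have Sn : (k.+1%:R : R) != 0 by rewrite pnatr_eq0.
apply: (mulfI Sn); rewrite lagnorm2S IH gS factS natrM.
have fn : (k`!%:R : R) != 0 by rewrite pnatr_eq0 -lt0n fact_gt0.
by field; rewrite ?nat1r Sn fn.
Qed.

Lemma lagnorm2_gt0 k : 0 < h k.
Proof. by rewrite lagnorm2E divr_gt0 ?Gamma_gt0// ltr0n fact_gt0. Qed.

Lemma nlaguerre_horner k t : nlaguerre a k t = (Num.sqrt (h k))^-1 * (lagp k).[t].
Proof.
by rewrite /nlaguerre laguerre_horner -sqrtrV ?ltW ?lagnorm2_gt0// lagnorm2E invf_div.
Qed.

Lemma inner_poly p q : inner a (horner p) (horner q) = wint a (p * q).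
Proof.
by apply: eq_Rintegral => t _; rewrite hornerM mulrA.
Qed.

(** * Bounds for coefficients, norms and values near 0 *)

Lemma coef0_lagp k : (lagp k)`_0 = h k / g 0.
Proof.
rewrite coef_poly /= subn0 expr0 fact0 divr1 mulr1 lagnorm2E.
by rewrite invfM mulrCA mulrA [in RHS]mulrC mulrA.
Qed.

(** The ratio of consecutive coefficients is at most k/(m+1) in absolute value, and L_k(0) = h_k /
    Gamma(a+1). Hence L_k is majorized by L_k(0) e^(kt). *)
Lemma norm_coef_lagp k m :
  `|(lagp k)`_m| <= h k / g 0 * (k%:R ^+ m / m`!%:R).
Proof.
have hg0 : 0 <= h k / g 0 by rewrite divr_ge0// ltW ?lagnorm2_gt0 ?Gamma_gt0.
elim: m => [|m IH].
  by rewrite coef0_lagp expr0 fact0 divr1 mulr1 ger0_norm.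
have m1 : 0 < (m.+1%:R : R) by rewrite ltr0n.
have mm : 0 < m.+1%:R * (m.+1%:R + a) :> R by rewrite mulr_gt0// ltr_wpDr.
rewrite -(ler_pM2l mm) -{1}(gtr0_norm mm) -normrM coef_lagp_succ normrM.
have [mk|km] := leqP m k; last first.
  rewrite coef_lagp_gt// normr0 mulr0.
  by rewrite mulr_ge0 ?(ltW mm)// mulr_ge0// divr_ge0// exprn_ge0.
apply: (@le_trans _ _ (k%:R * (h k / g 0 * (k%:R ^+ m / m`!%:R)))).
  rewrite ler_pM// distrC ger0_norm ?subr_ge0 ?ler_nat//.
  by rewrite gerBl.
have -> : k%:R * (h k / g 0 * (k%:R ^+ m / m`!%:R)) =
    m.+1%:R * (h k / g 0 * (k%:R ^+ m.+1 / (m.+1)`!%:R)).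
  have fn : (m`!%:R : R) != 0 by rewrite pnatr_eq0 -lt0n fact_gt0.
  rewrite factS natrM exprS; field.
  by rewrite ?nat1r fn g_neq0 gt_eqF.
rewrite ler_wpM2r//.
  rewrite mulr_ge0// divr_ge0// exprn_ge0//.
by rewrite ler_peMr ?(ltW m1)// -natr1 -addrA addrC -addrA lerDl addr_ge0.
Qed.

Lemma lagnorm2_le k : h k <= (1 + a) * h 0 * k.+1%:R `^ a.
Proof.
have h00 := ltW (lagnorm2_gt0 0).
have a10 : 0 <= 1 + a by rewrite addr_ge0.
case: k => [|k].
  by rewrite powR1 mulr1 ler_peMl// lerDl.
(* The induction shows the sharper bound with k^a for k >= 1; its base case is h_1 = (1 + a) h_0. *)
apply: (@le_trans _ _ ((1 + a) * h 0 * k.+1%:R `^ a)); last first.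
  by rewrite ler_wpM2l ?mulr_ge0// ge0_ler_powR// ?nnegrE// ler_nat.
elim: k => [|k IH].
  by have := lagnorm2S 0; rewrite !mul1r => ->; rewrite powR1 mulr1.
have k1 : 0 < k.+1%:R :> R by rewrite ltr0n.
have k2 : 0 < k.+2%:R :> R by rewrite ltr0n.
have -> : h k.+2 = h k.+1 * (1 + a / (k.+1%:R + 1)).
  apply: (mulfI (lt0r_neq0 k2)); rewrite lagnorm2S natr1.
  by field; rewrite ?nat1r ?gt_eqF.
have -> : k.+2%:R `^ a = k.+1%:R `^ a * ((k.+1%:R + 1) / k.+1%:R) `^ a.
  rewrite -powRM ?divr_ge0// ?addr_ge0//; congr (_ `^ _).
  by rewrite natr1; field; rewrite ?nat1r ?gt_eqF.
rewrite mulrA ler_pM ?(ltW (lagnorm2_gt0 _)) ?succ_ratio_powR_ge//.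
by rewrite addr_ge0// divr_ge0// addr_ge0.
Qed.

(** The ratio h_(k+1) / h_k = (k+1+a)/(k+1) dominates the ratio of consecutive lower bounds, by
    [succ_ratio_powR_le] at y = k+1. *)
Lemma lagnorm2_ge k : h 0 * ((k%:R + 1 + a) / (1 + a)) `^ a <= h k.
Proof.
have a1 : 0 < 1 + a by rewrite ltr_pwDl.
elim: k => [|k IH].
  by rewrite add0r divff ?gt_eqF// powR1 mulr1.
have k1 : 0 < k.+1%:R :> R by rewrite ltr0n.
have ka : 0 < k.+1%:R + a by rewrite ltr_wpDr.
have -> : h k.+1 = h k * ((k.+1%:R + a) / k.+1%:R).
  apply: (mulfI (lt0r_neq0 k1)); rewrite lagnorm2S.
  by field; rewrite ?nat1r ?gt_eqF.
have -> : ((k.+1%:R + 1 + a) / (1 + a)) `^ a =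
    ((k%:R + 1 + a) / (1 + a)) `^ a * ((k.+1%:R + a + 1) / (k.+1%:R + a)) `^ a.
  rewrite -powRM ?divr_ge0 ?addr_ge0//; congr (_ `^ _).
  rewrite natr1 [k.+1%:R + a + 1]addrAC; field.
  by rewrite ?nat1r ?gt_eqF.
rewrite mulrA ler_pM ?succ_ratio_powR_le ?powR_ge0//.
by rewrite mulr_ge0 ?powR_ge0// ltW ?lagnorm2_gt0.
Qed.

Let hg_ge0 k : 0 <= h k / g 0.
Proof. by rewrite divr_ge0// ltW ?lagnorm2_gt0 ?Gamma_gt0. Qed.

Lemma norm_lagp_sub_le k t : 0 <= t ->
  `|(lagp k).[t] - h k / g 0| <= h k / g 0 * (expR (k%:R * t) - 1).
Proof.
move=> t0; rewrite (horner_coef_wide _ (size_poly _ _)) big_ord_recl/=.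
rewrite expr0 mulr1 coef0_lagp addrC addKr.
apply: (@le_trans _ _ (h k / g 0 * (\sum_(m < k.+1) (k%:R * t) ^+ m / m`!%:R - 1))).
  rewrite big_ord_recl/= expr0 fact0 divr1 [1 + _]addrC addrK mulr_sumr.
  rewrite (le_trans (ler_norm_sum _ _ _))// ler_sum// => i _.
  rewrite normrM normrX (ger0_norm t0) exprMn [X in _ <= _ * X]mulrAC mulrA.
  by rewrite ler_wpM2r ?exprn_ge0// norm_coef_lagp.
by rewrite ler_wpM2l// lerD2r expR_sum_le// mulr_ge0.
Qed.

Lemma norm_lagp_le k t : 0 <= t ->
  `|(lagp k).[t]| <= h k / g 0 * expR (k%:R * t).
Proof.
move=> t0; have := norm_lagp_sub_le k t0; rewrite ler_distl ler_norml => /andP[].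
have := hg_ge0 k; have : 1 <= expR (k%:R * t).
  by rewrite -expR0 ler_expR mulr_ge0.
by move=> *; apply/andP; split; nra.
Qed.

(** Differentiation costs a factor i on the i-th coefficient; i <= 2^i accounts for the doubled
    exponent. *)
Lemma norm_Xderiv_lagp_le k t : 0 <= t ->
  `|t * (lagp k)^`().[t]| <= h k / g 0 * expR (2 * k%:R * t).
Proof.
move=> t0; rewrite -[X in X * _]hornerX -hornerM.
have szd : (size ('X * (lagp k)^`())%R <= k.+1)%N.
  rewrite (leq_trans (size_polyMleq _ _))// size_polyX /=.
  have [->|L0] := eqVneq (lagp k) 0; first by rewrite derivC size_poly0.
  by rewrite (leq_trans (lt_size_deriv L0))// size_poly.
rewrite (horner_coef_wide _ szd).
apply: (@le_trans _ _
  (h k / g 0 * (\sum_(m < k.+1) (2 * k%:R * t) ^+ m / m`!%:R))); last first.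
  by rewrite ler_wpM2l// expR_sum_le// !mulr_ge0.
rewrite mulr_sumr (le_trans (ler_norm_sum _ _ _))// ler_sum// => i _.
have -> : ('X * (lagp k)^`())`_i = i%:R * (lagp k)`_i.
  rewrite coefXM coef_deriv; case: (i : nat) => [|j] /=; first by rewrite mul0r.
  by rewrite mulr_natl.
rewrite !normrM normrX (ger0_norm t0) ger0_norm//.
rewrite exprMn [X in _ <= _ * X]mulrAC mulrA ler_wpM2r ?exprn_ge0//.
have -> : h k / g 0 * ((2 * k%:R) ^+ i / i`!%:R) =
    2 ^+ i * (h k / g 0 * (k%:R ^+ i / i`!%:R)) by rewrite exprMn; ring.
rewrite ler_pM ?norm_coef_lagp//.
by rewrite -natrX ler_nat ltnW// ltn_expl.
Qed.

End laguerre_polynomials.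

(** * Uniform bound for the Laguerre functions *)

Section laguerre_bound.
Variables (R : realType) (a : R).
Hypothesis a0 : 0 <= a.
Local Notation L k := (lagp a k).
Local Notation h := (lagnorm2 a).
Local Notation g0 := (Gamma (0%:R + a + 1)).
Local Notation K k := (k%:R + (a + 1) / 2).

(* x^(a/2) e^(-x/2) lagamp(x) is x times the derivative of
   x^(a/2) e^(-x/2) lagp(x). *)
Definition lagamp (k : nat) : {poly R} :=
  2^-1 *: ((a%:P - 'X) * L k) + 'X * (L k)^`().
Local Notation A k := (lagamp k).

Let K_gt0 k : 0 < K k.
Proof. by rewrite ltr_wpDl// divr_gt0// ltr_wpDl. Qed.

Lemma horner_lagamp k x :
  (A k).[x] = (a - x) / 2 * (L k).[x] + x * (L k)^`().[x].
Proof. by rewrite !hornerE /=; field. Qed.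

(** For k >= 1 the polynomial is (k + a) L_(k-1), with squared norm k (k + a) h_k; for k = 0 it is
    0. *)
Let wint_pred_le k :
  wint a ((k%:R *: L k - 'X * (L k)^`()) ^+ 2) <= 4 * K k ^+ 2 * h k.
Proof.
case: k => [|k].
  rewrite lagp0// derivC mulr0 scale0r subrr -[0 : {poly R}](scale0r 1).
  rewrite exprZn wintZ// expr0n mul0r.
  by rewrite mulr_ge0 ?(ltW (lagnorm2_gt0 _ _))// mulr_ge0// sqr_ge0.
rewrite lagp_derivX// opprB addrCA subrr addr0 exprZn wintZ// -/(h k).
rewrite expr2 -[leLHS]mulrA -lagnorm2S// mulrA ler_wpM2r ?(ltW (lagnorm2_gt0 _ _))//.
have k0 : 0 <= k%:R :> R by [].
have ak : 0 <= a * k%:R by rewrite mulr_ge0.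
by have := a0; rewrite -natr1; nra.
Qed.

Lemma wint_lagamp_le k : wint a (A k ^+ 2) <= 9 * K k ^+ 2 * h k.
Proof.
pose B := k%:R *: L k - 'X * (L k)^`().
pose U := k.+1%:R *: L k.+1.
(* [A k] is a combination of neighbours: [U] is (k+1) L_(k+1), and [B] is (k+a) L_(k-1), read as 0
   for k = 0. *)
have AE : A k = 2^-1 *: (U - L k - B).
  have e : 'X * L k = 'X * (L k)^`() - (U - (k.+1%:R + a) *: L k).
    by rewrite lagp_mulX// lagp_derivX.
  rewrite /lagamp mulrBl e /B /U -!mul_polyC -[k.+1%:R]natr1 !polyCD polyC1.
  set P := L k; set D := 'X * P^`().
  have c2 : D = 2^-1%:P * (D + D).
    by rewrite mulrDr -mulrDl -polyCD (_ : 2^-1 + 2^-1 = 1) ?mul1r//; field.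
  rewrite [X in _ + X = _]c2 -mulrDr; congr (_ * _); ring.
apply: (@le_trans _ _ (wint a ((3 / 4) *: (U ^+ 2 + L k ^+ 2 + B ^+ 2)))).
  apply: le_wint => // t _; rewrite AE !hornerE.
  set u := _ * (L k.+1).[t]; set v := (L k).[t]; set w := (k%:R * _ - _).
  by have := sqr_ge0 (u + v); have := sqr_ge0 (u + w); have := sqr_ge0 (v - w); nra.
rewrite wintZ// !wintD// exprZn wintZ// -!/(h _).
have := wint_pred_le k; rewrite -/B.
have -> : k.+1%:R ^+ 2 * h k.+1 = k.+1%:R * ((k.+1%:R + a) * h k).
  by rewrite -lagnorm2S// mulrA.
have h0 := lagnorm2_gt0 a0 k.
have k0 : 0 <= k%:R :> R by [].
have : (k.+1%:R * (k.+1%:R + a) + 1) * h k <= 8 * K k ^+ 2 * h k.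
  have ak : 0 <= a * k%:R by rewrite mulr_ge0.
  rewrite ler_wpM2r ?(ltW h0)// -[k.+1%:R]natr1.
  have := a0; have := sqr_ge0 a; have := sqr_ge0 (k%:R : R); move: k0 ak.
  by move: (k%:R) => x *; nra.
by lra.
Qed.

Lemma lagp_bound_far k x : 2 * K k <= x ->
  weight a x * (L k).[x] ^+ 2 <= 5 * h k.
Proof.
move=> Kx; have K0 := K_gt0 k; have h0 := lagnorm2_gt0 a0 k.
have x0 : 0 < x by lra.
rewrite -(ler_pM2l x0).
(* [Q] majorizes -(L_k^2 + 2 L_k A_k): the difference is K (L_k + A_k / K)^2 + L_k^2. Its weighted
   integral is at most (1 + 9) K h_k, hence at most 5 x h_k because 2K <= x. *)
pose Q : {poly R} := K k *: L k ^+ 2 + (K k)^-1 *: A k ^+ 2.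
have Q0 t : 0 <= Q.[t].
  rewrite hornerD !hornerZ !horner_exp.
  by rewrite addr_ge0// mulr_ge0 ?sqr_ge0 ?invr_ge0 ?(ltW K0).
apply: (@le_trans _ _ (wint a Q)); last first.
  rewrite wintD// !wintZ// -/(h k).
  have : (K k)^-1 * wint a (A k ^+ 2) <= (K k)^-1 * (9 * K k ^+ 2 * h k).
    by rewrite ler_wpM2l ?wint_lagamp_le// invr_ge0 ltW.
  have -> : (K k)^-1 * (9 * K k ^+ 2 * h k) = 9 * (K k * h k).
    by move: (K k) K0 => c c0; field; rewrite gt_eqF.
  have : 2 * K k * h k <= x * h k by rewrite ler_wpM2r// ltW.
  by nra.
pose q : {poly R} := L k ^+ 2 + 2%:P * (L k * A k).
(* In terms of [A k], the derivative of t w L_k^2 is w times [q]. *)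
have qE : (a + 1)%:P * L k ^+ 2 - 'X * L k ^+ 2 + 'X * (L k ^+ 2)^`() = q.
  have A2 : 2%:P * A k = (a%:P - 'X) * L k + 2%:P * ('X * (L k)^`()).
    by rewrite /lagamp -mul_polyC mulrDr [2%:P * (2^-1%:P * _)]mulrA
      -polyCM divff ?mul1r// pnatr_eq0.
  rewrite /q [2%:P * (_ * _)]mulrCA A2 expr2 derivM polyCD polyC1.
  rewrite (_ : 2%:P = 1 + 1 :> {poly R}); last by rewrite -polyCD.
  ring.
have := wint_deriv a0 (L k ^+ 2) (ltW x0); rewrite qE.
have -> : weight (a + 1) x * (L k ^+ 2).[x] = x * (weight a x * (L k).[x] ^+ 2).
  rewrite /weight powRD ?(gt_eqF x0) ?implybT// powRr1 ?(ltW x0)// horner_exp.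
  by ring.
move=> e; rewrite -[leLHS]opprK -e.
have sub : `]x, +oo[ `<=` halfline R.
  by move=> t /=; rewrite in_itv/= andbT; exact: lt_trans.
have int p : (@lebesgue_measure R).-integrable `]x, +oo[
    (EFin \o (fun t => weight a t * p.[t])).
  by apply: (integrableS _ _ _ (integrable_wpoly a0 p)) => //; exact: measurable_halfline.
apply: (@le_trans _ _
  (\int[@lebesgue_measure R]_(t in `]x, +oo[) (weight a t * Q.[t]))); last first.
  by apply: Rintegral_sub_wint.
rewrite -mulN1r -RintegralZl//.
apply: le_Rintegral => //.
- have := int (- q); apply: eq_integrable => // t _.
  by rewrite /= hornerN mulrN mulN1r.
- move=> t _; rewrite mulrCA ler_wpM2l ?weight_ge0// mulN1r.
  rewrite 2!hornerD !hornerZ !horner_exp 2!hornerM hornerC.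
  move: ((L k).[t]) ((A k).[t]) => l m.
  rewrite -subr_ge0.
  have -> : K k * l ^+ 2 + (K k)^-1 * m ^+ 2 - - (l ^+ 2 + 2 * (l * m)) =
     K k * (l + (K k)^-1 * m) ^+ 2 + l ^+ 2.
    by move: (K k) K0 => c c0; field; rewrite gt_eqF.
  by rewrite addr_ge0 ?sqr_ge0// mulr_ge0 ?sqr_ge0// ltW.
Qed.

(** With theta = x d/dx and u = x^(a/2) e^(-x/2) L_k, Laguerre's equation reads theta^2 u = - q u;
    this is q. It increases up to x = 2K. *)
Definition lagpot k : {poly R} := K k *: 'X - 4^-1 *: 'X^2 - (a ^+ 2 / 4)%:P.

Lemma horner_lagpot k x : (lagpot k).[x] = K k * x - x ^+ 2 / 4 - a ^+ 2 / 4.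
Proof.
by rewrite /lagpot !(hornerD, hornerN) !hornerZ hornerX hornerXn hornerC; ring.
Qed.

Lemma horner_deriv_lagpot k x : (lagpot k)^`().[x] = K k - x / 2.
Proof.
rewrite /lagpot !derivB !derivZ derivX derivXn derivC !(hornerD, hornerN) !hornerZ.
by rewrite hornerMn hornerX !hornerC; field.
Qed.

Lemma lagamp_deriv k x : x * (A k)^`().[x] =
  - (lagpot k).[x] * (L k).[x] - (a - x) / 2 * (A k).[x].
Proof.
rewrite horner_lagamp horner_lagpot.
have := congr1 (horner^~ x) (lagp_ode a0 k).
rewrite !(hornerD, hornerN, hornerM, hornerZ, hornerX, hornerC) => ode.
have -> : (A k)^`().[x] = ((a - x) * (L k)^`().[x] - (L k).[x]) / 2
    + (L k)^`().[x] + x * (L k)^`()^`().[x].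
  rewrite /lagamp derivD derivZ !derivM derivB derivX derivC.
  by rewrite !(hornerD, hornerN, hornerM, hornerZ, hornerX, hornerC); field.
have -> : x * (((a - x) * (L k)^`().[x] - (L k).[x]) / 2 +
   (L k)^`().[x] + x * (L k)^`()^`().[x]) =
   x * (((a - x) * (L k)^`().[x] - (L k).[x]) / 2 + (L k)^`().[x]) +
   x * ((- (k%:R * (L k).[x])) - (a + 1 - x) * (L k)^`().[x]).
  by rewrite -ode; ring.
by field.
Qed.

Definition sonin k (x : R) : R :=
  weight a x * ((L k).[x] ^+ 2 + (A k).[x] ^+ 2 / (lagpot k).[x]).

Lemma is_derive_weight (x : R) : 0 < x ->
  is_derive x 1 (weight a) (weight a x * (a - x) / x).
Proof.
move=> x0; have H1 := is_derive1_powR a x0.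
have H2 : is_derive x 1 (fun t : R => expR (- t)) (- expR (- x)).
  by apply: is_derive_eq; rewrite /GRing.scale/= mulrN1.
apply: is_derive_eq; rewrite /GRing.scale/= /weight.
rewrite powRB ?(gt_eqF x0) ?implybT// powRr1 ?(ltW x0)//.
by field; rewrite gt_eqF.
Qed.

(** By the differential equation everything cancels except the term from differentiating 1/q, so the
    derivative is nonpositive as long as q' = K - x/2 >= 0. *)
Lemma is_derive_sonin k (x : R) : 0 < x -> 0 < (lagpot k).[x] ->
  is_derive x 1 (sonin k)
    (- (weight a x * (K k - x / 2) * (A k).[x] ^+ 2 / (lagpot k).[x] ^+ 2)).
Proof.
move=> x0 q0; have q_neq0 := lt0r_neq0 q0.
have Hw := is_derive_weight x0.
have HL := is_derive_poly (L k) x.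
have HA := is_derive_poly (A k) x.
have Hq := is_deriveV q_neq0 (is_derive_poly (lagpot k) x).
apply: is_derive_eq.
rewrite /GRing.scale/= horner_deriv_lagpot.
have x_neq0 := lt0r_neq0 x0.
have LA : (L k)^`().[x] = ((A k).[x] - (a - x) / 2 * (L k).[x]) / x.
  by rewrite horner_lagamp; field.
have -> : (A k)^`().[x] = (- (lagpot k).[x] * (L k).[x] - (a - x) / 2 * (A k).[x]) / x.
  by rewrite -lagamp_deriv mulrC mulKf.
rewrite LA; move: (A k).[x] (L k).[x] (lagpot k).[x] q_neq0 => u v q qn0.
by field; rewrite x_neq0 qn0.
Qed.

Lemma lagpot_homo k x y : x <= y -> y <= 2 * K k ->
  (lagpot k).[x] <= (lagpot k).[y].
Proof.
move=> xy yK; rewrite !horner_lagpot -subr_ge0.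
rewrite (_ : _ - _ = (y - x) * (K k - (y + x) / 4)); last by field.
by rewrite mulr_ge0//; lra.
Qed.

Lemma sonin_le k (x1 x : R) : 0 < x1 -> x1 <= x -> x <= 2 * K k ->
  0 < (lagpot k).[x1] -> sonin k x <= sonin k x1.
Proof.
move=> x10 x1x x2K q1.
have q0 y : x1 <= y -> y <= 2 * K k -> 0 < (lagpot k).[y].
  by move=> x1y yK; apply: lt_le_trans q1 _; exact: lagpot_homo.
have dE y : x1 <= y -> y <= 2 * K k -> is_derive y 1 (sonin k)
    (- (weight a y * (K k - y / 2) * (A k).[y] ^+ 2 / (lagpot k).[y] ^+ 2)).
  by move=> x1y yK; apply: is_derive_sonin; rewrite ?q0//; exact: lt_le_trans x1y.
apply: (@ler0_derive1_le_cc _ (sonin k) x1 (2 * K k));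
  rewrite ?in_itv/= ?lexx ?x1x ?(le_trans x1x x2K)//.
- move=> y; rewrite in_itv/= => /andP[/ltW x1y /ltW yK].
  by have [] := dE y x1y yK.
- move=> y; rewrite in_itv/= => /andP[/ltW x1y /ltW yK].
  rewrite derive1E; have [_ ->] := dE y x1y yK.
  rewrite oppr_le0 mulr_ge0 ?invr_ge0 ?sqr_ge0//.
  rewrite mulr_ge0 ?sqr_ge0// mulr_ge0 ?weight_ge0//.
  by lra.
- apply: derivable_within_continuous => y; rewrite in_itv/= => /andP[x1y yK].
  by have [] := dE y x1y yK.
Qed.

(** For K x <= c both L_k and A_k are O(h_k), so the left side is O(x^a h_k^2); and x^a h_k is
    bounded because h_k = O((k+1)^a) and (k+1) x <= 2c. [A k] is included since it enters Sonin's
    function. *)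
Lemma lagp_bound_near (c : R) : exists C : R, forall k x, 0 < x -> K k * x <= c ->
  weight a x * ((L k).[x] ^+ 2 + (A k).[x] ^+ 2) <= C * h k.
Proof.
(* [D] serves both for L_k and for A_k: |A_k| <= |a - x|/2 |L_k| + |x L_k'|, where |a - x|/2 <= a +
   2c because x <= 2c. *)
pose D : R := (a + 2 * c + 1) * expR (2 * c).
exists (2 * D ^+ 2 * ((1 + a) * (2 * c) `^ a) / g0) => k x x0 Kxc.
have a0' := a0; have g00 : 0 < g0 by rewrite Gamma_gt0.
have k0 : 0 <= k%:R :> R by [].
have h0 := lagnorm2_gt0 a0 k.
have c0 : 0 < c by apply: lt_le_trans Kxc; rewrite mulr_gt0.
have kxc : k%:R * x <= c.
  by apply: le_trans Kxc; rewrite ler_wpM2r ?(ltW x0)//; lra.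
have x2c : x <= 2 * c by nra.
have hg : 0 <= h k / g0 by rewrite divr_ge0 ?ltW.
have eL : `|(L k).[x]| <= h k / g0 * expR (2 * c).
  apply: le_trans (norm_lagp_le a0 k (ltW x0)) _.
  by rewrite ler_wpM2l// ler_expR; lra.
have eT : `|x * (L k)^`().[x]| <= h k / g0 * expR (2 * c).
  apply: le_trans (norm_Xderiv_lagp_le a0 k (ltW x0)) _.
  by rewrite ler_wpM2l// ler_expR; lra.
have D1 : expR (2 * c) <= D.
  by rewrite -[leLHS]mul1r ler_wpM2r ?expR_ge0//; lra.
have D0 : 0 <= D by apply: le_trans D1; rewrite expR_ge0.
have LD : `|(L k).[x]| <= h k / g0 * D.
  by apply: le_trans eL _; rewrite ler_wpM2l.
have AD : `|(A k).[x]| <= h k / g0 * D.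
  rewrite horner_lagamp (le_trans (ler_normD _ _))// normrM.
  have e1 : `|(a - x) / 2| <= a + 2 * c by rewrite ler_norml; lra.
  apply: (@le_trans _ _
    ((a + 2 * c) * (h k / g0 * expR (2 * c)) + h k / g0 * expR (2 * c))).
    by rewrite lerD// ler_pM.
  by rewrite /D le_eqVlt; apply/orP; left; apply/eqP; ring.
have sq y : `|y| <= h k / g0 * D -> y ^+ 2 <= (h k / g0 * D) ^+ 2.
  move=> yD; rewrite -(real_normK (num_real y)) lerXn2r// nnegrE.
  exact: le_trans yD.
have hx : x `^ a * h k <= (1 + a) * g0 * (2 * c) `^ a.
  apply: (@le_trans _ _ (x `^ a * ((1 + a) * h 0 * k.+1%:R `^ a))).
    by rewrite ler_wpM2l ?powR_ge0// lagnorm2_le.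
  rewrite lagnorm2E// fact0 divr1 mulrCA -powRM ?(ltW x0)//.
  rewrite ler_wpM2l ?mulr_ge0 ?addr_ge0 ?(ltW g00)//.
  by rewrite ge0_ler_powR ?nnegrE// ?mulr_ge0 ?(ltW x0) ?(ltW c0)// -natr1; nra.
apply: (@le_trans _ _ (x `^ a * (2 * (h k / g0 * D) ^+ 2))).
  rewrite ler_pM ?weight_ge0 ?addr_ge0 ?sqr_ge0//.
    by rewrite /weight ler_piMr ?powR_ge0// expR_le1; lra.
  by have := sq _ LD; have := sq _ AD; lra.
have -> : x `^ a * (2 * (h k / g0 * D) ^+ 2) =
    (x `^ a * h k) * (2 * D ^+ 2 * h k / g0 ^+ 2).
  by field; rewrite gt_eqF.
apply: le_trans (ler_wpM2r _ hx) _.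
  apply: mulr_ge0; last by rewrite invr_ge0 sqr_ge0.
  apply: mulr_ge0; last exact: ltW.
  by apply: mulr_ge0 => //; exact: sqr_ge0.
by rewrite le_eqVlt; apply/orP; left; apply/eqP; field; rewrite gt_eqF.
Qed.

Lemma lagp_bound : exists2 C : R, 0 < C & forall k x, 0 < x ->
  weight a x * (L k).[x] ^+ 2 <= C * h k.
Proof.
(* Chosen so that q >= 1 at x1 = c/K whenever x1 <= 2K: then x1^2 <= 2c and q(x1) >= c - c/2 - a^2/4
   = 1. *)
pose c : R := a ^+ 2 / 2 + 2.
have [C CP] := lagp_bound_near c.
exists (`|C| + 5) => [|k x x0]; first by rewrite ltr_wpDl.
have K0 := K_gt0 k; have h0 := lagnorm2_gt0 a0 k.
have CC : C * h k <= (`|C| + 5) * h k.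
  by rewrite ler_wpM2r ?(ltW h0)// (le_trans (ler_norm _))// lerDl.
have near y : 0 < y -> K k * y <= c ->
    weight a y * ((L k).[y] ^+ 2 + (A k).[y] ^+ 2) <= (`|C| + 5) * h k.
  by move=> y0 yc; exact: le_trans (CP k y y0 yc) CC.
have [x2K|/ltW x2K] := leP (2 * K k) x.
  apply: le_trans (lagp_bound_far x2K) _.
  by rewrite ler_wpM2r ?(ltW h0)// lerDr.
have [xc|/ltW xc] := leP (K k * x) c.
  apply: le_trans (near x x0 xc).
  by rewrite ler_wpM2l ?weight_ge0// lerDl sqr_ge0.
pose x1 := c / K k.
have c0 : 0 < c by have := sqr_ge0 a; rewrite /c; lra.
have x10 : 0 < x1 by rewrite divr_gt0.
have Kx1 : K k * x1 = c by rewrite /x1 mulrC divfK ?gt_eqF.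
have x1x : x1 <= x by rewrite -(ler_pM2l K0) Kx1.
have q1 : 1 <= (lagpot k).[x1].
  rewrite horner_lagpot Kx1.
  have : x1 ^+ 2 <= 2 * c by rewrite -Kx1; nra.
  by rewrite /c; lra.
(* Sonin's function carries the value at [x] back to [x1], where q >= 1 gives A_k^2/q <= A_k^2 and
   the bound near 0 applies. *)
apply: le_trans (near x1 x10 _); last by rewrite Kx1.
have q0 : 0 < (lagpot k).[x1] by lra.
apply: (@le_trans _ _ (sonin k x)).
  rewrite ler_wpM2l ?weight_ge0// lerDl mulr_ge0 ?sqr_ge0// invr_ge0 ltW//.
  by apply: lt_le_trans q0 _; exact: lagpot_homo.
apply: le_trans (sonin_le x10 x1x x2K q0) _.
rewrite ler_wpM2l ?weight_ge0// lerD2l ler_piMr ?sqr_ge0//.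
by rewrite invf_le1.
Qed.

End laguerre_bound.

(** * Normalized Laguerre functions *)

Section laguerre_functions.
Variables (R : realType) (a : R).
Hypothesis a0 : 0 <= a.
Local Notation L k := (lagp a k).
Local Notation h := (lagnorm2 a).
Local Notation g0 := (Gamma (0%:R + a + 1)).

Let sqrth_gt0 k : 0 < Num.sqrt (h k).
Proof. by rewrite sqrtr_gt0 lagnorm2_gt0. Qed.

Definition nlagp k : {poly R} := (Num.sqrt (h k))^-1 *: L k.

Lemma nlaguerreE k : nlaguerre a k = horner (nlagp k).
Proof. by apply/funext => t; rewrite nlaguerre_horner// hornerZ. Qed.

Lemma wint_nlagp j k : wint a (nlagp j * nlagp k) = (j == k)%:R.
Proof.
rewrite /nlagp -scalerAl -scalerAr !wintZ//.
have [<-|jk] := eqVneq j k; last by rewrite wint_lagp_orth// !mulr0.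
rewrite -expr2 -/(h j) -[X in _ * (_ * X)]sqr_sqrtr ?ltW ?lagnorm2_gt0//.
by rewrite expr2 mulKf ?mulVf// gt_eqF.
Qed.

Lemma laguerre_function_bound : exists2 M : R, 0 < M & forall k t, 0 < t ->
  `|nlaguerre a k t * Num.sqrt (weight a t)| <= M.
Proof.
have [C C0 CP] := lagp_bound a0.
exists (Num.sqrt C) => [|k t t0]; first by rewrite sqrtr_gt0.
rewrite nlaguerreE hornerZ -sqrtr_sqr ler_wsqrtr// !exprMn exprVn.
rewrite !sqr_sqrtr ?weight_ge0 ?(ltW (lagnorm2_gt0 _ _))//.
rewrite mulrAC -mulrA mulrC ler_pdivrMr ?lagnorm2_gt0//.
exact: CP.
Qed.

(* At the scale t ~ 1/k the polynomial is still close to its value at 0. *)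
Lemma laguerre_function_ge : exists2 c : R, 0 < c & forall N k : nat,
  (0 < N)%N -> (N < k <= N.*2)%N ->
  c <= nlaguerre a k (8 * N%:R)^-1 * Num.sqrt (weight a (8 * N%:R)^-1).
Proof.
have g00 : 0 < g0 by rewrite Gamma_gt0.
have a1 : 0 < 1 + a by rewrite ltr_pwDl.
(* Lower bound for h_k w(t), which is at least h_0 ((k+1+a) t / (1+a))^a e^(-t); here (k+1+a) t >= N
   t = 1/8 and t <= 1. *)
pose d : R := h 0 * ((8 * (1 + a))^-1 `^ a * expR (- 1)).
have d0 : 0 < d.
  by rewrite mulr_gt0 ?lagnorm2_gt0// mulr_gt0 ?expR_gt0// powR_gt0// invr_gt0 mulr_gt0.
exists (Num.sqrt d / (2 * g0)) => [|N k N0 /andP[Nk kN]].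
  by rewrite divr_gt0 ?sqrtr_gt0// mulr_gt0.
have N0' : 1 <= N%:R :> R by rewrite ler1n.
set t : R := (8 * N%:R)^-1.
have t0 : 0 < t by rewrite invr_gt0 mulr_gt0 ?ltr0n.
have Nt : N%:R * t = 8^-1 by rewrite /t; field; lra.
have kt : k%:R * t <= 4^-1.
  apply: (@le_trans _ _ (N.*2%:R * t)).
    by rewrite ler_wpM2r ?(ltW t0)// ler_nat.
  by rewrite -muln2 natrM mulrAC Nt; lra.
have h0 := lagnorm2_gt0 a0 k.
have hg : 0 < h k / g0 by rewrite divr_gt0.
(* k t <= 1/4 gives e^(kt) <= 3/2, so L_k(t) deviates from L_k(0) by at most half of L_k(0). *)
have Lge : h k / (2 * g0) <= (L k).[t].
  have e : expR (k%:R * t) <= 3 / 2.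
    apply: (@le_trans _ _ (expR 4^-1)); first by rewrite ler_expR.
    have := expRxMexpNx_1 (4^-1 : R); have := expR_ge1Dx (- 4^-1 : R).
    by have := expR_gt0 (4^-1 : R); nra.
  have := norm_lagp_sub_le a0 k (ltW t0); rewrite ler_distl => /andP[+ _].
  rewrite (_ : h k / (2 * g0) = h k / g0 / 2); last by field; rewrite gt_eqF.
  by nra.
have wh : d <= h k * weight a t.
  rewrite /d; apply: (@le_trans _ _
    (h 0 * ((k%:R + 1 + a) / (1 + a)) `^ a * weight a t)); last first.
    by rewrite ler_wpM2r ?weight_ge0// lagnorm2_ge.
  rewrite -mulrA ler_wpM2l ?(ltW (lagnorm2_gt0 _ _))// /weight mulrA.
  have ka : 0 <= (k%:R + 1 + a) / (1 + a) by rewrite divr_ge0 ?addr_ge0.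
  have kat : (8 * (1 + a))^-1 <= (k%:R + 1 + a) / (1 + a) * t.
    rewrite invfM mulrAC ler_wpM2r ?invr_ge0 ?(ltW a1)// -Nt ler_wpM2r ?(ltW t0)//.
    by rewrite -addrA ler_wpDr ?addr_ge0// ler_nat ltnW.
  rewrite -powRM ?(ltW t0)// ler_pM ?powR_ge0 ?expR_ge0//.
    have e0 : 0 <= (8 * (1 + a))^-1 by rewrite invr_ge0 mulr_ge0 ?(ltW a1).
    by rewrite ge0_ler_powR// nnegrE (le_trans e0 kat).
  rewrite ler_expR lerN2; nra.
rewrite nlaguerreE hornerZ.
apply: (@le_trans _ _
  ((Num.sqrt (h k))^-1 * (h k / (2 * g0)) * Num.sqrt (weight a t))); last first.
  by rewrite ler_wpM2r ?sqrtr_ge0// ler_wpM2l// invr_ge0 sqrtr_ge0.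
rewrite mulrA -[X in _ * X / _]sqr_sqrtr ?(ltW h0)// expr2.
rewrite mulKf ?(gt_eqF (sqrth_gt0 _))//.
rewrite mulrAC -sqrtrM ?(ltW h0)// ler_wpM2r ?invr_ge0 ?mulr_ge0 ?(ltW g00)//.
by rewrite ler_wsqrtr.
Qed.

Definition extremal (lam : R) (N : nat) : {poly R} :=
  \sum_(i < N) lam *: nlagp (N.+1 + i)%N.

Lemma coeff_extremal lam N k :
  coeff a (horner (extremal lam N)) k = \sum_(i < N) lam * ((N.+1 + i)%N == k)%:R.
Proof.
rewrite /coeff nlaguerreE inner_poly /extremal mulr_suml.
rewrite (big_morph (wint a) (fun p q => wintD a0 p q) (_ : _ = 0)); last first.
  by rewrite -(scale0r 0) wintZ// mul0r.
by apply: eq_bigr => i _; rewrite -scalerAl wintZ// wint_nlagp.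
Qed.

Lemma L2w_poly p : L2w a (horner p).
Proof.
split.
  apply: measurable_funTS; apply: continuous_measurable_fun => x.
  exact: continuous_horner.
apply: eq_integrable (integrable_wpoly a0 (p ^+ 2)) => [|t _].
  exact: measurable_halfline.
by rewrite /= horner_exp mulrC.
Qed.

End laguerre_functions.

(** * Tails of the Fourier series *)

(** The sum telescopes against k^(1-p) / (p-1), a discrete form of comparison with the integral; one
    step is [succ_ratio_powR_ge] with exponent p - 1. *)
Lemma sum_powRN_le (R : realType) (p : R) (N n : nat) : 1 < p -> (0 < N)%N ->
  \sum_(N.+1 <= k < n) k%:R `^ (- p) <= N%:R `^ (1 - p) / (p - 1).
Proof.
move=> p1 N0; have p10 : 0 < p - 1 by rewrite subr_gt0.
have [nN|Nn] := leqP n N.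
  by rewrite big_geq ?leqW// divr_ge0 ?powR_ge0// ltW.
rewrite -(subnKC Nn); move: (n - N.+1)%N => m {n Nn}.
suff : \sum_(N.+1 <= k < N.+1 + m) k%:R `^ (- p) <=
    (N%:R `^ (1 - p) - (N + m)%:R `^ (1 - p)) / (p - 1).
  move=> /le_trans; apply; rewrite ler_wpM2r ?invr_ge0 ?(ltW p10)//.
  by rewrite gerBl powR_ge0.
elim: m => [|m IH]; first by rewrite addn0 big_geq// addn0 subrr mul0r.
rewrite addnS big_nat_recr ?leq_addr//=.
apply: (le_trans (lerD IH (lexx _))); rewrite addSn addnS.
have y0 : 0 < (N + m)%:R :> R by rewrite ltr0n addn_gt0 N0.
move: (N + m)%N y0 => y y0.
rewrite -(ler_pM2r p10) mulrDl !divfK ?(gt_eqF p10)//.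
suff : (y.+1%:R `^ (- p)) * (p - 1) + y.+1%:R `^ (1 - p) <= y%:R `^ (1 - p) by lra.
have yS : 0 < y.+1%:R :> R by rewrite ltr0n.
have e1 : y.+1%:R `^ (- p) = y.+1%:R `^ (1 - p) / y.+1%:R :> R.
  rewrite -[X in _ / X](powRr1 (ltW yS)) -powRB ?(gt_eqF yS) ?implybT//.
  by congr (_ `^ _); lra.
have := succ_ratio_powR_ge (ltW p10) y0; rewrite natr1 => ratio.
have -> : y%:R `^ (1 - p) = y.+1%:R `^ (1 - p) * (y.+1%:R / y%:R) `^ (p - 1).
  rewrite powRM ?invr_ge0 ?(ltW y0) ?(ltW yS)// mulrA -powRD ?(gt_eqF yS) ?implybT//.
  rewrite (_ : 1 - p + (p - 1) = 0); last by lra.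
  by rewrite powRr0 mul1r -powR_inv1 ?(ltW y0)// -powRrM; congr (_ `^ _); lra.
rewrite e1 mulrAC -[X in _ + X]mulr1 -mulrA -mulrDr ler_wpM2l ?powR_ge0//.
by rewrite addrC.
Qed.

(** The bound on the finite tails also gives absolute convergence, so that [limn] is the true
    sum. *)
Lemma lim_series_tail_le (R : realType) (u : nat -> R) (N : nat) (B : R) :
  (forall n, \sum_(N <= k < n) `|u k| <= B) ->
  `|limn (series u) - \sum_(k < N) u k| <= B.
Proof.
move=> uB; have B0 : 0 <= B by have := uB 0%N; rewrite big_geq.
have cu : cvgn (series u).
  apply: normed_cvg; rewrite (_ : [normed series u] = series (fun k => `|u k|))//.
  apply: nondecreasing_is_cvgn.
    by apply/nondecreasing_seqP => n; rewrite /series/= big_nat_recr//= lerDl.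
  exists (\sum_(0 <= k < N) `|u k| + B) => _ [n _ <-].
  have [nN|/ltnW Nn] := leqP n N.
    rewrite /series/= (big_cat_nat (n := n) (p := N))//=.
    by rewrite -addrA lerDl addr_ge0 ?sumr_ge0.
  by rewrite /series/= (big_cat_nat (n := N) (p := n))//= lerD2l.
rewrite -(big_mkord xpredT u) ler_distl; apply/andP; split.
  apply: limr_ge => //; exists N => // n /= Nn.
  rewrite /series/= (big_cat_nat (n := N) (p := n))//= lerD2l.
  rewrite lerNl (le_trans _ (uB n))// (le_trans _ (ler_norm_sum _ _ _))//.
  by rewrite -normrN ler_norm.
apply: limr_le => //; exists N => // n /= Nn.
rewrite /series/= (big_cat_nat (n := N) (p := n))//= lerD2l.
by rewrite (le_trans (ler_norm _))// (le_trans (ler_norm_sum _ _ _)).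
Qed.

Section coeff_tail.
Variables (R : realType) (a mu : R).

Let tail_infty (f : R -> R) (N n : nat) : 1 < mu -> (0 < N)%N ->
  (Wnorm a +oo mu f <= 1)%E ->
  \sum_(N.+1 <= k < n) `|coeff a f k| <= (mu - 1)^-1 * N%:R `^ (1 - mu).
Proof.
move=> mu1 N0 Wf.
rewrite mulrC; apply: le_trans (sum_powRN_le n mu1 N0).
rewrite !big_nat; apply: ler_sum => k /andP[Nk _].
have k0 : (0 < k)%N by exact: leq_trans Nk.
have : (((maxn 1 k)%:R `^ mu * `|coeff a f k|)%:E <= 1)%E.
  by apply: le_trans Wf; apply: ereal_sup_ubound; exists k.
rewrite lee_fin (maxn_idPr k0) => le1.
by rewrite powRN -[leRHS]mul1r ler_pdivlMr ?powR_gt0 ?ltr0n// mulrC.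
Qed.

Let Wnorm_fin_sum (r : R) (f : R -> R) (N n : nat) : 1 <= r -> (0 < N)%N ->
  (Wnorm a r%:E mu f <= 1)%E ->
  \sum_(N.+1 <= k < n) (k%:R `^ mu * `|coeff a f k|) `^ r <= 1.
Proof.
move=> r1 N0; rewrite /Wnorm; set S := (\sum_(0 <= k <oo) _)%E => Wf.
have r0 : 0 < r by lra.
have u0 k : (0 <= ((maxn 1 k)%:R `^ (r * mu) * `|coeff a f k| `^ r)%:E)%E.
  by rewrite lee_fin mulr_ge0 ?powR_ge0.
have S0 : (0 <= S)%E by apply: nneseries_ge0.
have S1 : (S <= 1)%E.
  (* The outer power is undone: S = (S^(1/r))^r <= 1. *)
  rewrite -(poweRe1 S0) -[X in (S `^ X)%E](mulVf (lt0r_neq0 r0)) poweRrM.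
  rewrite -(poweR1r r); apply: gt0_ler_poweR; rewrite ?in_itv/= ?andbT ?(ltW r0)//.
    by rewrite poweR_ge0 leey.
  by rewrite lee_fin ler01 leey.
rewrite -lee_fin; apply: le_trans S1.
(* Truncation at max(n, N+1) keeps the splitting at N+1 valid even if n <= N. *)
have := @nneseries_lim_ge _
  (fun k => ((maxn 1 k)%:R `^ (r * mu) * `|coeff a f k| `^ r)%:E)
  xpredT 0 (maxn n N.+1) (fun k _ _ => u0 k).
apply: le_trans; rewrite sumEFin lee_fin.
rewrite (big_cat_nat (n := N.+1) (p := maxn n N.+1))//= ?leq_maxr//.
rewrite ler_wpDl//; first by rewrite sumr_ge0// => k _; rewrite mulr_ge0 ?powR_ge0.
have [nN|Nn] := leqP n N.
  by rewrite big_geq ?leqW// sumr_ge0// => k _; rewrite mulr_ge0 ?powR_ge0.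
rewrite (maxn_idPl Nn) !big_nat ler_sum// => k /andP[Nk _].
have k0 : (0 < k)%N by exact: leq_trans Nk.
by rewrite powRM ?powR_ge0// (maxn_idPr k0) -powRrM [mu * r]mulrC.
Qed.

(** For s = 1 the conjugate exponent is infinite; k^mu >= N^mu on the tail takes the place of
    Young's inequality. *)
Let tail_one (f : R -> R) (N n : nat) : 0 < mu -> (0 < N)%N ->
  (Wnorm a 1 mu f <= 1)%E ->
  \sum_(N.+1 <= k < n) `|coeff a f k| <= N%:R `^ (- mu).
Proof.
move=> mu0 N0 Wf; rewrite powRN -[leRHS]mul1r ler_pdivlMr ?powR_gt0 ?ltr0n//.
apply: le_trans (Wnorm_fin_sum n (lexx 1) N0 Wf).
rewrite mulr_suml !big_nat; apply: ler_sum => k /andP[Nk _].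
rewrite powRr1 ?mulr_ge0 ?powR_ge0// mulrC ler_wpM2r//.
by rewrite ge0_ler_powR ?nnegrE ?(ltW mu0)// ler_nat ltnW.
Qed.

Let tail_fin (r : R) (f : R -> R) (N n : nat) : 1 < r -> 1 - r^-1 < mu -> (0 < N)%N ->
  (Wnorm a r%:E mu f <= 1)%E ->
  \sum_(N.+1 <= k < n) `|coeff a f k| <=
  (1 + (mu / (1 - r^-1) - 1)^-1) * N%:R `^ (1 - mu - r^-1).
Proof.
move=> r1 mur N0 Wf.
have r0 : 0 < r by lra.
have ri : 0 < 1 - r^-1 by rewrite subr_gt0 invf_lt1.
pose q := (1 - r^-1)^-1; have q0 : 0 < q by rewrite invr_gt0.
have rq : r^-1 + q^-1 = 1 by rewrite /q invrK; lra.
(* As 1/q = 1 - 1/r, the assumption on [mu] says exactly that the conjugate series of k^(-mu q)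
   converges. *)
have qmu : 1 < mu * q by rewrite ltr_pdivlMr// mul1r.
pose e := 1 - mu - r^-1.
have NR : 0 < N%:R :> R by rewrite ltr0n.
(* [d] balances the two terms of Young's inequality: d^r and d^(-q) N^(1 - mu q) both equal N^e. *)
pose d : R := N%:R `^ (e / r).
have d0 : 0 < d by rewrite powR_gt0.
have sum1 := Wnorm_fin_sum n (ltW r1) N0 Wf.
have sum2 := sum_powRN_le n qmu N0.
(* Young's inequality applied to (d k^mu |c_k|) (k^-mu / d). *)
apply: (@le_trans _ _ (d `^ r * (\sum_(N.+1 <= k < n) (k%:R `^ mu * `|coeff a f k|) `^ r)
   + (d^-1) `^ q * \sum_(N.+1 <= k < n) k%:R `^ (- (mu * q)))).
  rewrite !mulr_sumr -big_split/= !big_nat; apply: ler_sum => k /andP[Nk _].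
  have k0 : 0 < k%:R :> R by rewrite ltr0n (leq_trans _ Nk).
  have x0 : 0 <= k%:R `^ mu * `|coeff a f k| by rewrite mulr_ge0 ?powR_ge0.
  rewrite [leLHS](_ : _ =
    (d * (k%:R `^ mu * `|coeff a f k|)) * (d^-1 * k%:R `^ (- mu))); last first.
    by rewrite powRN; field; rewrite (gt_eqF d0) gt_eqF// powR_gt0.
  apply: (le_trans (conjugate_powR _ _ r0 q0 rq)).
  - by rewrite mulr_ge0 ?(ltW d0).
  - by rewrite mulr_ge0 ?invr_ge0 ?powR_ge0 ?(ltW d0).
  have q1 : 1 <= q by rewrite /q invf_ge1// gerBl invr_ge0 ltW.
  rewrite lerD//.
    rewrite [(d * _) `^ r]powRM ?(ltW d0)// ler_piMr ?mulr_ge0 ?powR_ge0//.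
    by rewrite invf_le1 ?(ltW r1).
  rewrite powRM ?invr_ge0 ?powR_ge0 ?(ltW d0)// -powRrM mulNr.
  by rewrite ler_piMr ?mulr_ge0 ?powR_ge0// invf_le1.
have dr : d `^ r = N%:R `^ e.
  by rewrite /d -powRrM divfK ?gt_eqF.
have dq : (d^-1) `^ q * N%:R `^ (1 - mu * q) = N%:R `^ e.
  rewrite -powR_inv1 ?(ltW d0)// /d -!powRrM -powRD ?(gt_eqF NR) ?implybT//.
  congr (_ `^ _); rewrite /e /q; field.
  by rewrite subr_eq0 !gt_eqF.
rewrite mulrDl mul1r -/e lerD//.
  by rewrite dr ler_piMr ?powR_ge0.
by rewrite -dq [leRHS]mulrCA ler_wpM2l ?powR_ge0// [leRHS]mulrC.
Qed.

(** The cases s = +oo, s = 1 and 1 < s < +oo are treated apart; [fine (s^-1)] is 0 for s = +oo. *)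
Lemma coeff_tail_le (s : \bar R) : (1 <= s)%E -> 1 - fine (s^-1)%E < mu -> 0 < mu ->
  exists2 C : R, 0 < C & forall (f : R -> R) (N n : nat), (0 < N)%N ->
    (Wnorm a s mu f <= 1)%E ->
    \sum_(N.+1 <= k < n) `|coeff a f k| <= C * N%:R `^ (- mu - fine (s^-1)%E + 1).
Proof.
case: s => [r| |//]; last first.
  rewrite invey/= !subr0 => _ mu1 mu0; exists (mu - 1)^-1 => [|f N n N0 Wf].
    by rewrite invr_gt0 subr_gt0.
  by rewrite [- mu + 1]addrC; exact: tail_infty.
rewrite lee_fin => r1; rewrite inver gt_eqF/=; last by lra.
rewrite le_eqVlt in r1; case/predU1P: r1 => [<-|r1] mur mu0.
  exists 1 => // f N n N0 Wf; rewrite invr1 subrK mul1r; exact: tail_one.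
have ri : 0 < 1 - r^-1 by rewrite subr_gt0 invf_lt1//; lra.
exists (1 + (mu / (1 - r^-1) - 1)^-1) => [|f N n N0 Wf].
  by rewrite ltr_wpDr// invr_ge0 subr_ge0 ler_pdivlMr// mul1r ltW.
rewrite (_ : - mu - r^-1 + 1 = 1 - mu - r^-1); last by ring.
exact: tail_fin.
Qed.

End coeff_tail.

(** * Two-sided estimate *)

Section corollary.
Variables (R : realType) (a : R).
Hypothesis a0 : 0 <= a.

Lemma eps_le (s : \bar R) (mu : R) :
  (1 <= s)%E -> 1 - fine (s^-1)%E < mu -> 0 < mu ->
  exists2 C : R, 0 < C & forall N : nat, (0 < N)%N ->
    (eps a s mu N <= (C * N%:R `^ (- mu - fine (s^-1)%E + 1))%:E)%E.
Proof.
move=> s1 mus mu0.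
have [M M0 MP] := laguerre_function_bound a0.
have [C C0 CP] := coeff_tail_le a s1 mus mu0.
exists (M * C) => [|N N0]; first by rewrite mulr_gt0.
apply: ge_ereal_sup => _ [f [_ Wf] <-]; apply: ge_ereal_sup => _ [t t0 <-].
rewrite lee_fin /remainder /cont_rep /partial_sum mulr_suml.
apply: lim_series_tail_le => n.
apply: (@le_trans _ _ (M * \sum_(N.+1 <= k < n) `|coeff a f k|)).
  rewrite mulr_sumr; apply: ler_sum => k _.
  by rewrite -mulrA normrM mulrC ler_wpM2r// MP.
by rewrite -mulrA ler_wpM2l ?(ltW M0)// CP.
Qed.

Lemma coeff_extremal_if lam N k : coeff a (horner (extremal a lam N)) k =
  if (N < k <= N.*2)%N then lam else 0.
Proof.
rewrite coeff_extremal//; case: ifPn => [/andP[Nk kN]|Nk].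
  have kN' : (k - N.+1 < N)%N by lia.
  rewrite (bigD1 (Ordinal kN'))//= subnKC// eqxx mulr1 big1 ?addr0// => i.
  rewrite -val_eqE/= => ik; rewrite (_ : (_ == _) = false) ?mulr0//.
  by apply/negbTE; apply: contra ik => /eqP <-; rewrite addKn.
apply: big1 => i _; rewrite (_ : (_ == _) = false) ?mulr0//.
apply/negbTE; apply: contra Nk => /eqP <-; have := ltn_ord i; lia.
Qed.

Lemma sum_block_le (B : R) (N n : nat) : 0 <= B ->
  \sum_(0 <= k < n) (if (N < k <= N.*2)%N then B else 0) <= N%:R * B.
Proof.
(* Sharper count for the induction: min(n, 2N+1) - (N+1) block indices lie below [n], with truncated
   subtraction. *)
move=> B0; apply: (@le_trans _ _ ((minn n N.*2.+1 - N.+1)%N%:R * B)); last first.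
  by rewrite ler_wpM2r// ler_nat; lia.
elim: n => [|n IH]; first by rewrite big_geq// mulr_ge0.
rewrite big_nat_recr//=; apply: (le_trans (lerD IH (lexx _))).
case: ifPn => [Nn|_]; last by rewrite addr0 ler_wpM2r// ler_nat; lia.
by rewrite -{2}(mul1r B) -mulrDl ler_wpM2r// natr1 ler_nat; lia.
Qed.

(** On the block k^mu <= (2N)^mu, so for finite s each of its N terms contributes at most 1/N to the
    sum; for s = +oo the second factor of the scalar is 1. *)
Lemma Wnorm_extremal_le (s : \bar R) (mu : R) (N : nat) :
  (1 <= s)%E -> 0 < mu -> (0 < N)%N ->
  (Wnorm a s mu (horner (extremal a
     (N.*2%:R `^ (- mu) * N%:R `^ (- fine (s^-1)%E)) N)) <= 1)%E.
Proof.
move=> s1 mu0 N0; set lam := _ * _.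
have lam0 : 0 <= lam by rewrite mulr_ge0 ?powR_ge0.
have NR : 0 < N%:R :> R by rewrite ltr0n.
have N2R : 0 < N.*2%:R :> R by rewrite ltr0n double_gt0.
have kmu k : (N < k <= N.*2)%N -> (maxn 1 k)%:R `^ mu <= N.*2%:R `^ mu :> R.
  move=> /andP[Nk kN]; rewrite ge0_ler_powR ?nnegrE ?(ltW mu0)// ler_nat; lia.
have N2mu : N.*2%:R `^ mu * N.*2%:R `^ (- mu) = 1 :> R.
  by rewrite powRN divff// gt_eqF// powR_gt0.
case: s s1 @lam lam0 => [r| |//]; last first.
  rewrite invey/= oppr0 powRr0 mulr1 => _ lam0.
  apply: ge_ereal_sup => _ [k _ <-]; rewrite coeff_extremal_if.
  case: ifPn => kN; last by rewrite normr0 mulr0 lee_fin.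
  by rewrite lee_fin ger0_norm// -[leRHS]N2mu ler_wpM2r ?kmu.
rewrite lee_fin => r1; have r0 : 0 < r by lra.
rewrite inver gt_eqF//=; set lam := _ * _ => lam0.
rewrite -(poweR1r r^-1); apply: gt0_ler_poweR;
  rewrite ?in_itv/= ?andbT ?invr_ge0 ?(ltW r0)//.
- by rewrite leey andbT; apply: nneseries_ge0 => k _ _;
  rewrite lee_fin mulr_ge0 ?powR_ge0.
- by rewrite lee_fin ler01 leey.
apply: lime_le.
  apply: is_cvg_nneseries => k _ _; rewrite lee_fin mulr_ge0 ?powR_ge0//.
apply: nearW => n; rewrite sumEFin lee_fin.
apply: (@le_trans _ _
  (\sum_(0 <= k < n) (if (N < k <= N.*2)%N then N%:R^-1 else 0))); last first.
  by apply: le_trans (sum_block_le _ _ _) _; rewrite ?invr_ge0// divff ?gt_eqF.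
apply: ler_sum => k _; rewrite coeff_extremal_if; case: ifPn => kN; last first.
  by rewrite normr0 powR0 ?mulr0// gt_eqF.
rewrite ger0_norm// mulrC [r * mu]mulrC powRrM -powRM ?powR_ge0//.
apply: (@le_trans _ _ ((N%:R `^ (- r^-1)) `^ r)); last first.
  by rewrite -powRrM mulNr mulVf ?gt_eqF// powR_inv1 ?(ltW NR).
apply: ge0_ler_powR; rewrite ?nnegrE ?mulr_ge0 ?powR_ge0 ?(ltW r0)//.
rewrite mulrC mulrA -[leRHS]mul1r ler_wpM2r ?powR_ge0// -[leRHS]N2mu.
by rewrite ler_wpM2r ?powR_ge0 ?kmu.
Qed.

Lemma eps_ge (s : \bar R) (mu : R) : (1 <= s)%E -> 0 < mu ->
  exists2 c : R, 0 < c & forall N : nat, (0 < N)%N ->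
    ((c * N%:R `^ (- mu - fine (s^-1)%E + 1))%:E <= eps a s mu N)%E.
Proof.
move=> s1 mu0; have [c c0 cP] := laguerre_function_ge a0.
(* The factor 2^(-mu) comes from (2N)^(-mu) in [lam]. *)
exists (c * 2 `^ (- mu)) => [|N N0]; first by rewrite mulr_gt0 ?powR_gt0.
have NR : 0 < N%:R :> R by rewrite ltr0n.
set sig := fine _.
pose lam : R := N.*2%:R `^ (- mu) * N%:R `^ (- sig).
have lam0 : 0 <= lam by rewrite mulr_ge0 ?powR_ge0.
pose f := horner (extremal a lam N).
pose t : R := (8 * N%:R)^-1.
have t0 : 0 < t by rewrite invr_gt0 mulr_gt0.
have rem_ge : N%:R * (lam * c) <= remainder a N f t.
  (* All frequencies of [f] exceed N, so its partial sum is 0. *)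
  rewrite /remainder /partial_sum big1 ?mul0r ?subr0; last first.
    by move=> i _; rewrite coeff_extremal_if ltnNge -ltnS ltn_ord mul0r.
  pose u k := coeff a f k * nlaguerre a k t * Num.sqrt (weight a t).
  have -> : cont_rep a f t = \sum_(N.+1 <= k < N.*2.+1) u k.
    (* Only finitely many terms are nonzero: the partial sums are constant from 2N+1 on. *)
    apply: (@lim_near_cst _ (@norm_hausdorff _ _)); exists N.*2.+1 => // n /= Nn.
    rewrite /series/= (big_cat_nat (n := N.+1))//=; last by lia.
    rewrite (big_cat_nat (n := N.*2.+1) (m := N.+1))//=; last by lia.
    have u0 k : ~~ (N < k <= N.*2)%N -> u k = 0.
      by move=> /negbTE kN; rewrite /u coeff_extremal_if kN !mul0r.
    rewrite [X in X + _]big_nat [X in X + _]big1 ?add0r; last first.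
      by move=> k kN; apply: u0; lia.
    rewrite [X in _ + X]big_nat [X in _ + X]big1 ?addr0//.
    by move=> k kN; apply: u0; lia.
  have -> : N%:R * (lam * c) = \sum_(N.+1 <= k < N.*2.+1) lam * c.
    rewrite sumr_const_nat mulr_natl; congr (_ *+ _); lia.
  rewrite !big_nat; apply: ler_sum => k /andP[Nk kN].
  rewrite /u coeff_extremal_if Nk -ltnS kN /= -mulrA ler_wpM2l// cP//.
  by rewrite Nk -ltnS.
have -> : c * 2 `^ (- mu) * N%:R `^ (- mu - sig + 1) = N%:R * (lam * c).
  rewrite /lam -muln2 natrM powRM// !powRD ?(gt_eqF NR) ?implybT// powRr1 ?(ltW NR)//.
  by ring.
apply: (@le_trans _ _ (Cnorm (remainder a N f))).
  apply: (@le_trans _ _ `|remainder a N f t|%:E).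
    by rewrite lee_fin (le_trans rem_ge)// ler_norm.
  by apply: ereal_sup_ubound; exists t.
apply: ereal_sup_ubound; exists f => //; split; first exact: L2w_poly.
exact: Wnorm_extremal_le.
Qed.

End corollary.

Unset Implicit Arguments.

Theorem corollary4p4 (R : realType) (alpha : R) (s : \bar R) (mu : R)
  (halpha : 0 <= alpha) (hs : (1 <= s)%E)
  (hmus : 1 - fine (s^-1)%E < mu) (hmu : 0 < mu) :
  exists c1 c2 : R, [/\ 0 < c1, 0 < c2 &
    forall N : nat, (1 <= N)%N ->
      ((c1 * N%:R `^ (- mu - fine (s^-1)%E + 1))%:E <= eps alpha s mu N)%E /\
      (eps alpha s mu N <= (c2 * N%:R `^ (- mu - fine (s^-1)%E + 1))%:E)%E].
Proof.
have [c2 c20 c2P] := eps_le halpha hs hmus hmu.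
have [c1 c10 c1P] := eps_ge halpha hs hmu.
by exists c1, c2; split => // N N1; split; [exact: c1P|exact: c2P].
Qed.
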